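(* Let $1\le l\le d$ and, for $N\ge1$, let $B_N^l=[0,N-1]^l\times\{0\}^{d-l}\subset\mathbb{Z}^d$. Let the random vector $(X_1,X_2,\ldots,X_{N^l})$ be the sites of $B_N^l$ ordered by the level at which they are covered (ties, i.e. several sites covered at the same level, being broken for example by the lexicographic order), so that $$M(B_N^l)=U_{X_1}\ge U_{X_2}\ge\cdots\ge U_{X_{N^l}}.$$ Then for all $k\ge2$, $$\lim_{\delta\to0}\limsup_{N\to\infty}\mathbb{P}(\exists\,1\le i<j\le k\text{ such that }|X_i-X_j|\le\delta N)=0.$$
   Context: Throughout $d\ge 3$; $|\cdot|$ is the Euclidean norm on $\mathbb{Z}^d$. The set $[0,N-1]^l\times\{0\}^{d-l}$ regarded as a subset of $\mathbb{Z}^d$ consists of its integer points, so it has $N^l$ elements. In the $\limsup$ only $N$ with $N^l\ge k$ matter. $P_x$ is the law of simple random walk $(Y_n)_{n\ge0}$ on $\mathbb{Z}^d$ started at $x$. For a finite set $K\subset\mathbb{Z}^d$ let $\tilde H_K=\inf\{n\ge1: Y_n\in K\}$, $e_K(x)=P_x(\tilde H_K=\infty)1_K(x)$, and $\operatorname{cap}(K)=\sum_{x\in K}e_K(x)$. Random interlacements. Let $W$ be the space of doubly infinite nearest-neighbor paths $w:\mathbb{Z}\to\mathbb{Z}^d$ that spend finite time in bounded subsets of $\mathbb{Z}^d$, and let $W^\star=W/\sim$, where $w\sim v$ if $w(\cdot)=v(\cdot+N)$ for some $N\in\mathbb{Z}$. Let $\nu$ be the unique $\sigma$-finite measure on $W^\star$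 such that for every finite $K\subset\mathbb{Z}^d$ the restriction of $\nu$ to the set of trajectories modulo time-shift that enter $K$ is the image under $W\to W^\star$ of the finite measure $Q_K$ on $W$ given by $Q_K[(w(-n))_{n\ge0}\in E, w(0)=x,(w(n))_{n\ge0}\in F]=P_x(E\mid\tilde H_K=\infty)\,e_K(x)\,P_x(F)$ (interpreted as $0$ if $e_K(x)=0$). Under $\mathbb{P}$, let $\omega=\sum_i\delta_{(w_i^\star,u_i)}$ be a Poisson point process on $W^\star\times[0,\infty)$ with intensity measure $\nu\otimes du$. The random interlacement at level $u\ge0$ is $\mathcal{I}^u=\bigcup_{i: u_i\le u}\operatorname{range}(w_i^\star)\subset\mathbb{Z}^d$, where $\operatorname{range}(w^\star)$ is the set of vertices visited by $w^\star$. For each $u$ its law is characterized by $\mathbb{P}(A\cap\mathcal{I}^u=\varnothing)=\exp(-u\operatorname{cap}(A))$ for all finite $A\subset\mathbb{Z}^d$. Cover levels: $U_x=\inf\{u\ge0: x\in\mathcal{I}^u\}$ for $x\in\mathbb{Z}^d$, and for finite $A\subset\mathbb{Z}^d$, $M(A)=\inf\{u\ge0: A\subset\mathcal{I}^u\}=\max_{x\in A}U_x$. *)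

(* Defs.v *)
From HB Require Import structures.
From mathcomp Require Import all_boot all_order all_algebra.
From mathcomp Require Import generic_quotient.
From mathcomp Require Import all_classical all_reals all_analysis.
From mathcomp Require Import measurable_realfun.

Set Implicit Arguments.
Unset Strict Implicit.
Unset Printing Implicit Defensive.
Import Order.TTheory GRing.Theory Num.Theory.
Import numFieldNormedType.Exports.

Local Open Scope classical_set_scope.
Local Open Scope ring_scope.
Local Open Scope quotient_scope.

HB.instance Definition _ := isPointed.Build int 0.

(* The lattice Z^d.  The dimension is written d.-1.+1, which is d as soon as
   0 < d, because every measurableType is pointed and there are no
   nearest-neighbour paths in Z^0. *)
Notation Zd d := 'rV[int]_d.-1.+1.

Definition sqnorm (d : nat) (x : Zd d) : int := \sum_i (x ord0 i) ^+ 2.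

Definition enorm (R : realType) (d : nat) (x : Zd d) : R :=
  Num.sqrt (sqnorm x)%:~R.

Definition neighbors (d : nat) (x y : Zd d) : bool := sqnorm (y - x) == 1.

Definition bounded_sites (d : nat) (B : set (Zd d)) : Prop :=
  exists r : int, forall x, B x -> sqnorm x <= r.

(* B_N^l = [0, N - 1]^l x {0}^(d - l) *)
Definition box (d l N : nat) : set (Zd d) :=
  [set x : Zd d | forall i : 'I_d.-1.+1,
     if (i < l)%N then 0 <= x ord0 i < N%:Z else x ord0 i == 0].

Definition walk_cylinders (d : nat) : set (set (nat -> Zd d)) :=
  [set A | exists n x, A = [set y | y n = x]].

Definition walk (d : nat) : Type := g_sigma_algebraType (@walk_cylinders d).
HB.instance Definition _ (d : nat) := Measurable.on (walk d).

Definition srw_step (R : realType) (d : nat) (x y : Zd d) : R :=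
  if neighbors x y then (2 * d)%:R^-1 else 0.

Definition srw_law (R : realType) (d : nat) (x : Zd d)
    (P : probability (walk d) R) : Prop :=
  forall (n : nat) (y : nat -> Zd d),
    P [set w | forall i, (i <= n)%N -> w i = y i] =
    ((y 0%N == x)%:R * \prod_(i < n) srw_step R (y i) (y i.+1))%:E.

(* the event that the return time inf {n >= 1 : Y_n \in K} is infinite *)
Definition escape (d : nat) (K : set (Zd d)) : set (walk d) :=
  [set w | forall n, (0 < n)%N -> ~ K (w n)].

Definition equilibrium (R : realType) (d : nat)
    (P : Zd d -> probability (walk d) R) (K : set (Zd d)) (x : Zd d) : R :=
  fine (P x (escape K)) * \1_K x.

Section trajectories.

Definition is_traj (d : nat) : set (int -> Zd d) :=
  [set w | (forall n, neighbors (w n) (w (n + 1))) /\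
           (forall B, bounded_sites B -> finite_set [set n | B (w n)])].

Definition traj (d : nat) : Type := set_type (@is_traj d).
HB.instance Definition _ (d : nat) := Choice.on (traj d).

Definition at_time (d : nat) (w : traj d) (n : int) : Zd d := val w n.

Lemma is_traj_line (d : nat) :
  is_traj (fun n : int => (\row_j (if j == ord0 then n else 0) : Zd d)).
Proof.
have sqE n : sqnorm (\row_j (if j == ord0 then n else 0) : Zd d) = n ^+ 2.
  rewrite /sqnorm (bigD1 ord0)//= mxE eqxx big1 ?addr0// => i i0.
  by rewrite mxE (negbTE i0) expr0n.
split=> [n|B [r Br]].
  rewrite /neighbors [X in sqnorm X](_ : _ =
    (\row_j (if j == ord0 then 1 else 0) : Zd d)) ?sqE ?expr1n//.
  apply/rowP => j; rewrite !mxE; case: ifP => _; last by rewrite subr0.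
  by rewrite addrAC subrr add0r.
have F : finite_set [set n : int | exists2 m : nat,
    (m < `|r|.+1)%N & n = m%:Z \/ n = - m%:Z].
  apply: (@sub_finite_set _ _ ((fun m : nat => m%:Z) @` `I_(`|r|.+1) `|`
                               (fun m : nat => - m%:Z) @` `I_(`|r|.+1))).
    by move=> n [m mr [->|->]]; [left|right]; exists m.
  by rewrite finite_setU; split; apply: finite_image; exact: finite_II.
apply: sub_finite_set F => n /Br; rewrite sqE => nr.
exists `|n|%N.
  rewrite ltnS -lez_nat !abszE.
  apply: le_trans (le_trans nr (ler_norm r)).
  rewrite -[leRHS]real_normK ?num_real// expr2.
  have [->|n0] := eqVneq `|n| 0; first by rewrite mul0r.
  by rewrite ler_peMr// -gtz0_ge1 lt_def n0 normr_ge0.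
rewrite abszE; case: (ger0P n) => _; [by left|by right; rewrite opprK].
Qed.

HB.instance Definition _ (d : nat) :=
  isPointed.Build (traj d) (SigSub (mem_set (@is_traj_line d))).

Definition traj_cylinders (d : nat) : set (set (traj d)) :=
  [set A | exists n x, A = [set w | at_time w n = x]].

HB.instance Definition _ (d : nat) :=
  Measurable.copy (traj d) (g_sigma_algebraType (@traj_cylinders d)).

Definition shift_rel (d : nat) (w v : traj d) : bool :=
  `[< exists N : int, forall n, at_time w n = at_time v (n + N) >].

Lemma shift_rel_refl (d : nat) : reflexive (@shift_rel d).
Proof. by move=> w; apply/asboolP; exists 0 => n; rewrite addr0. Qed.

Lemma shift_rel_sym (d : nat) : symmetric (@shift_rel d).
Proof.
have H (w v : traj d) : shift_rel w v -> shift_rel v w.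
  by move=> /asboolP[N wv]; apply/asboolP; exists (- N) => n; rewrite wv subrK.
by move=> w v; apply/idP/idP => /H.
Qed.

Lemma shift_rel_trans (d : nat) : transitive (@shift_rel d).
Proof.
move=> v w z /asboolP[M wv] /asboolP[N vz]; apply/asboolP.
by exists (M + N) => n; rewrite wv vz addrA.
Qed.

Canonical shift_equiv (d : nat) :=
  EquivRel (@shift_rel d) (@shift_rel_refl d) (@shift_rel_sym d)
    (@shift_rel_trans d).

Definition Wstar (d : nat) : Type := {eq_quot (@shift_rel d)}.
HB.instance Definition _ (d : nat) := Choice.on (Wstar d).
HB.instance Definition _ (d : nat) := EqQuotient.on (Wstar d).

Definition modshift (d : nat) (w : traj d) : Wstar d := \pi_(Wstar d) w.

HB.instance Definition _ (d : nat) :=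
  isPointed.Build (Wstar d) (modshift point).

Definition Wstar_measurable (d : nat) : set (set (Wstar d)) :=
  image_set_system setT (@modshift d) measurable.

Let Wstar_sigma_algebra (d : nat) :
  sigma_algebra setT (@Wstar_measurable d).
Proof. by apply: sigma_algebra_image; exact: sigma_algebra_measurable. Qed.

Let Wstar_measurable0 (d : nat) : @Wstar_measurable d set0.
Proof. by case: (Wstar_sigma_algebra d). Qed.

Let Wstar_measurableC (d : nat) (A : set (Wstar d)) :
  Wstar_measurable A -> Wstar_measurable (~` A).
Proof. by case: (Wstar_sigma_algebra d) => _ + _ mA => /(_ _ mA); rewrite setTD. Qed.

Let Wstar_measurable_bigcup (d : nat) (F : (set (Wstar d))^nat) :
  (forall i, Wstar_measurable (F i)) -> Wstar_measurable (\bigcup_i (F i)).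
Proof. by case: (Wstar_sigma_algebra d) => _ _ /(_ F). Qed.

HB.instance Definition _ (d : nat) :=
  @isMeasurable.Build default_measure_display (Wstar d) (@Wstar_measurable d)
    (@Wstar_measurable0 d) (@Wstar_measurableC d) (@Wstar_measurable_bigcup d).

Definition range_mod (d : nat) (ws : Wstar d) : set (Zd d) :=
  [set x | exists2 w, modshift w = ws & exists n, at_time w n = x].

Definition entering (d : nat) (K : set (Zd d)) : set (Wstar d) :=
  [set ws | exists2 x, K x & range_mod ws x].

End trajectories.

Section interlacement_intensity.
Variables (R : realType) (d : nat) (P : Zd d -> probability (walk d) R).

Definition forward (w : traj d) : walk d := fun n : nat => at_time w n%:Z.
Definition backward (w : traj d) : walk d := fun n : nat => at_time w (- n%:Z).

(* P_x(E | escape K) e_K(x) P_x(F); as x / 0 = 0, this is 0 if e_K(x) = 0. *)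
Definition is_QK (K : set (Zd d)) (Q : set (traj d) -> \bar R) : Prop :=
  forall (E F : set (walk d)) (x : Zd d), measurable E -> measurable F ->
    Q [set w | [/\ E (backward w), at_time w 0 = x & F (forward w)]] =
    (fine (P x (E `&` escape K)) / fine (P x (escape K)) *
     equilibrium P K x * fine (P x F))%:E.

Definition interlacement_intensity (nu : set (Wstar d) -> \bar R) : Prop :=
  forall K : set (Zd d), finite_set K ->
    exists2 Q : {finite_measure set (traj d) -> \bar R}, is_QK K Q &
      forall A, measurable A ->
        nu (A `&` entering K) = Q (@modshift d @^-1` A).

End interlacement_intensity.

Section poisson_point_process.
Context {R : realType} {dT dS : measure_display}.
Variables (T : measurableType dT) (S : measurableType dS).

(* A point process is an at most countable family of points indexed by nat;
   an index sent to None carries no point. *)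
Definition point_measure (pts : nat -> option S) (A : set S) : \bar R :=
  (\sum_(0 <= i <oo) (if pts i is Some s then \d_s A else 0))%E.

(* poisson_pmf is not used here, as its value at rate 0 is constantly 1. *)
Definition poisson_rv (P : probability T R) (N : T -> \bar R) (m : \bar R)
    : Prop :=
  if m is r%:E then
    forall n : nat,
      P [set t | N t = n%:R%:E] = (r ^+ n / n`!%:R * expR (- r))%:E
  else P [set t | N t = +oo%E] = 1%E.

Definition poisson_point_process (P : probability T R) (mu : set S -> \bar R)
    (pts : nat -> T -> option S) : Prop :=
  let N A t := point_measure (pts ^~ t) A in
  [/\ forall A, measurable A -> measurable_fun setT (N A),
      forall A, measurable A -> poisson_rv P (N A) (mu A) &
      forall (n : nat) (A : 'I_n -> set S) (B : 'I_n -> set (\bar R)),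
        (forall i, measurable (A i)) -> trivIset setT A ->
        (forall i, measurable (B i)) ->
        P [set t | forall i, B i (N (A i) t)] =
        (\prod_(i < n) P [set t | B i (N (A i) t)])%E].

End poisson_point_process.

Section interlacements.
Context {R : realType} {dT : measure_display} {T : measurableType dT}.
Variable d : nat.
Implicit Types (pts : nat -> T -> option (Wstar d * measurableTypeR R)).

(* The points live in W* x [0, +oo[, seen as a subset of W* x R. *)
Definition interlacement_process (PP : probability T R)
    (nu : {sigma_finite_measure set (Wstar d) -> \bar R}) pts : Prop :=
  (forall i t p, pts i t = Some p -> 0 <= p.2 :> R) /\
  poisson_point_process PP
    (fun A => (nu \x (@lebesgue_measure R))%E (A `&` [set p | 0 <= p.2 :> R]))
    pts.

Definition interlacement pts (u : R) (t : T) : set (Zd d) :=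
  [set x | exists i ws v,
     [/\ pts i t = Some (ws, v), v <= u & range_mod ws x]].

Definition cover_level_site pts (t : T) (x : Zd d) : \bar R :=
  ereal_inf [set u%:E | u in [set u : R | 0 <= u /\ interlacement pts u t x]].

Definition cover_level pts (t : T) (A : set (Zd d)) : \bar R :=
  ereal_inf
    [set u%:E | u in [set u : R | 0 <= u /\ A `<=` interlacement pts u t]].

(* (X 1, ..., X n) is a random vector listing the n sites of A by decreasing
   cover level; no tie-breaking rule is imposed. *)
Definition cover_ordering pts (A : set (Zd d)) (n : nat)
    (X : nat -> T -> Zd d) : Prop :=
  [/\ forall i x, (1 <= i <= n)%N -> measurable [set t | X i t = x],
      forall t, set_bij [set i | (1 <= i <= n)%N] A (X ^~ t) &
      forall t i j, (1 <= i)%N -> (i <= j)%N -> (j <= n)%N ->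
        (cover_level_site pts t (X j t) <= cover_level_site pts t (X i t))%E].

Lemma interlacement_mono pts t (u v : R) : u <= v ->
  interlacement pts u t `<=` interlacement pts v t.
Proof.
move=> uv x [i [ws [z [e zu xw]]]]; exists i, ws, z; split => //.
exact: le_trans uv.
Qed.

Lemma cover_ordering_max pts A n X t : (1 <= n)%N ->
  cover_ordering pts A n X ->
  cover_level pts t A = cover_level_site pts t (X 1%N t).
Proof.
move=> n1 [_ bij ord]; have [fA _ sA] := bij t.
apply/eqP; rewrite eq_le; apply/andP; split; last first.
  apply: ereal_inf_le_tmp => _ [u [u0 Au] <-]; exists u => //; split => //.
  by apply/Au/fA => /=; rewrite n1.
apply: le_ereal_inf_tmp => _ [u [u0 Xu] <-].
apply/lee_addgt0Pr => e e0; rewrite -EFinD.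
apply: ereal_inf_lbound; exists (u + e) => //; split.
  by rewrite addr_ge0// ltW.
move=> _ /sA[j /= /andP[j1 jn] <-].
have : (cover_level_site pts t (X j t) < (u + e)%:E)%E.
  apply: le_lt_trans (ord t 1%N j isT j1 jn) _.
  apply: (@le_lt_trans _ _ u%:E); last by rewrite lte_fin ltrDl.
  by apply: ereal_inf_lbound; exists u.
case/ereal_inf_lt => _ [v [_ Xv] <-]; rewrite lte_fin => /ltW vu.
exact: interlacement_mono vu _ Xv.
Qed.

End interlacements.

(* Main.v *)
Require Import Defs.
From HB Require Import structures.
From mathcomp Require Import all_boot all_order all_algebra.
From mathcomp Require Import generic_quotient.
From mathcomp Require Import zify ring lra.
From mathcomp Require Import all_classical all_reals all_analysis.
From mathcomp Require Import measurable_realfun.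

(** Write c for the capacity of a site and n = N^l for the number of sites of
    the box.  At level u a site is vacant with probability exp(-uc), so at
    level u = (log n - s)/c the expected number of vacant sites is exactly
    e^s.  Two things are shown, in the limit of large N.

    - The number of vacant sites at this level is at least k, up to a
      probability of order e^(-s); this is Chebyshev's inequality
      ([occurrences_second_moment], [few_vacant_prob]).  When it happens, the
      first k sites in the order of covering are vacant at every lower level
      ([late_sites_vacant]).
    - At the slightly lower level with s + 1 in place of s, the expected number
      of pairs of distinct vacant sites at distance at most delta N is at most
      of order delta e^(2s) ([close_vacant_prob]).

    So the probability of a close pair among the first k sites is bounded by a
    multiple of e^(-s) + delta e^(2s), and one lets delta and then 1/s go to 0.
    Using two levels makes ties between covering levels harmless.

    Both parts need the probability exp(-u cap{x,y}) that two sites are vacant,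
    summed over pairs of the box, hence lower bounds on cap{x,y}.

    - For all x <> y, cap{x,y} >= c + c^2/4 ([pair_cap_near]), so that a pair
      has probability at most (e^s/n)^(1 + c/4).  This bound is used for
      |x - y| <= N^(c/8): there are at most n (3 N^(c/8))^l such pairs, and
      their contribution vanishes.
    - For |x - y| > N^(c/8), cap{x,y} is 2c up to an error 6 N^(-c/16)
      ([pair_cap_far]).  As u is of order log N the error is negligible, and
      the pair has probability about e^(2s)/n^2, as if the sites were
      independent.

    The near bound comes from the intensity measure nu of trajectories.
    Writing e(x) for the probability that the walk from x never returns to
    {x,y}, one has cap{x,y} = e(x) + e(y) >= c, so that one of the two, say
    e(x), is at least c/2.  The trajectories that visit x and avoid y have
    nu-measure at least e(x)^2: it suffices that, from a visit of x on, the
    walk into the past and an independent walk into the future both never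
    return to {x,y}.  Hence cap{x,y} >= c + e(x)^2.

    Transience (c > 0) and the far bound both come from one explicit function:
    (|x|^2 + 63)^(-1/4) is superharmonic for the walk when d >= 3
    ([potential_superharmonic]).  It bounds hitting probabilities from above
    ([avoid_site_ge]), decays polynomially, and is strictly largest at 0.  *)

Set Implicit Arguments.
Unset Strict Implicit.
Unset Printing Implicit Defensive.
Import Order.TTheory GRing.Theory Num.Theory.
Import numFieldNormedType.Exports.

Local Open Scope classical_set_scope.
Local Open Scope ring_scope.

(** * A positive superharmonic function on Z^d, d at least 3 *)

Section quartic.
Variable R : realType.
Implicit Types r t v : R.

Definition inv4rt r : R := (Num.sqrt (Num.sqrt r))^-1.

Lemma inv4rt_gt0 r : 0 < r -> 0 < inv4rt r.
Proof. by move=> r0; rewrite invr_gt0 !sqrtr_gt0. Qed.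

Lemma inv4rtX r : 0 < r -> inv4rt r ^+ 4 = r^-1.
Proof.
by move=> r0; rewrite exprVn (exprM _ 2 2) !sqr_sqrtr ?sqrtr_ge0// ltW.
Qed.

Lemma inv4rtM r t : 0 < r -> inv4rt (r * t) = inv4rt r * inv4rt t.
Proof.
by move=> r0; rewrite /inv4rt !sqrtrM ?sqrtr_ge0 ?invfM// ltW.
Qed.

Lemma inv4rt_lt r t : 0 < r -> r < t -> inv4rt t < inv4rt r.
Proof.
move=> r0 rt; have t0 := lt_trans r0 rt.
by rewrite ltf_pV2 ?posrE ?sqrtr_gt0// !ltr_sqrt ?sqrtr_gt0.
Qed.

(** The Taylor expansion has 5/32 as second coefficient; the larger 3/16 pays
    for the remainder, and is the largest coefficient that the comparison in
    [potential_superharmonic] allows for d = 3. *)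
Lemma inv4rt1D_le t : - 8^-1 <= t <= 8^-1 ->
  inv4rt (1 + t) <= 1 - t / 4 + 3 / 16 * t ^+ 2.
Proof.
move=> /andP[t1 t2].
have t0 : 0 < 1 + t by lra.
set q := (X in _ <= X); have q0 : 0 < q by rewrite /q; nra.
rewrite -(@ler_pXn2r _ 4)// ?nnegrE; [|exact/ltW/inv4rt_gt0|exact: ltW].
rewrite inv4rtX// -div1r ler_pdivrMr//.
(* L is a quadratic lower bound of q^2, so that the degree 9 polynomial
   q^4 (1 + t) is replaced by L^2 (1 + t). *)
pose L := 1 - t / 2 + 27 / 64 * t ^+ 2.
have L0 : 0 <= L by rewrite /L; nra.
have qL : L <= q ^+ 2.
  have -> : q ^+ 2 = L + t ^+ 2 * (64^-1 - 3 / 32 * t + 9 / 256 * t ^+ 2).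
    by rewrite /q /L; field.
  by rewrite lerDl mulr_ge0 ?sqr_ge0//; nra.
apply: (@le_trans _ _ (L ^+ 2 * (1 + t))); last first.
  by rewrite ler_pM2r// (exprM _ 2 2) ler_sqr// nnegrE (le_trans L0).
have -> : L ^+ 2 * (1 + t) = 1 + t ^+ 2 * (3 / 32 + 43 / 64 * t -
    27 / 64 * t ^+ 2 + (27 / 64) ^+ 2 * (t ^+ 2 * (1 + t))).
  by rewrite /L; field.
rewrite lerDl mulr_ge0 ?sqr_ge0//.
have : 0 <= (27 / 64) ^+ 2 * (t ^+ 2 * (1 + t)).
  by rewrite mulr_ge0 ?sqr_ge0// mulr_ge0 ?sqr_ge0// ltW.
nra.
Qed.

Lemma inv4rt_step_ge v : 0 <= v < 1 -> 1 + v / 4 <= inv4rt (1 - v).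
Proof.
move=> /andP[v0 v1].
have t0 : 0 < 1 - v by lra.
rewrite -(@ler_pXn2r _ 4)// ?nnegrE; [|lra|exact/ltW/inv4rt_gt0].
rewrite inv4rtX// -[leRHS]div1r ler_pdivlMr//.
have -> : (1 + v / 4) ^+ 4 * (1 - v) = 1 - v ^+ 2 * (5 / 8 + v * (5 / 16 +
   v * (15 / 256 + v / 256))) by field.
rewrite gerBl mulr_ge0 ?sqr_ge0//; nra.
Qed.

End quartic.

Section lattice.
Variable d : nat.
Implicit Types (x y z : Zd d) (a : 'I_d.-1.+1 * bool).

Definition unit_step a : Zd d := (-1) ^+ a.2 *: delta_mx ord0 a.1.

Lemma sqnorm_ge0 x : 0 <= sqnorm x.
Proof. by apply: sumr_ge0 => i _; rewrite sqr_ge0. Qed.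

Lemma sqnorm0 : sqnorm (0 : Zd d) = 0.
Proof. by rewrite /sqnorm big1// => i _; rewrite mxE expr0n. Qed.

Lemma sqnormN x : sqnorm (- x) = sqnorm x.
Proof. by apply: eq_bigr => i _; rewrite mxE sqrrN. Qed.

Lemma sqnorm_coord x i : x ord0 i ^+ 2 <= sqnorm x.
Proof.
by rewrite /sqnorm (bigD1 i)//= lerDl sumr_ge0// => j _; rewrite sqr_ge0.
Qed.

Lemma unit_stepE a i : unit_step a ord0 i = if i == a.1 then (-1) ^+ a.2 else 0.
Proof. by rewrite !mxE eqxx/=; case: eqP; rewrite ?mulr1 ?mulr0. Qed.

Lemma sqnorm_step x a :
  sqnorm (x + unit_step a) = sqnorm x + 1 + 2 * (-1) ^+ a.2 * x ord0 a.1.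
Proof.
rewrite /sqnorm (bigD1 a.1)//= [in RHS](bigD1 a.1)//= mxE unit_stepE eqxx.
under eq_bigr => i /negbTE i1 do rewrite mxE unit_stepE i1 addr0.
by case: a.2; rewrite ?expr0 ?expr1; ring.
Qed.

Lemma unit_step_inj : injective unit_step.
Proof.
move=> [i b] [j c] /rowP/[dup] /(_ i) + /(_ j).
rewrite !unit_stepE/= !eqxx; case: eqP => [<-|_]; last by case: b.
by rewrite eqxx; case: b; case: c.
Qed.

Lemma neighbors_step x a : neighbors x (x + unit_step a).
Proof.
rewrite /neighbors addrAC subrr.
by rewrite sqnorm_step sqnorm0 mxE mulr0 addr0 add0r.
Qed.

Lemma card_unit_step : (0 < d)%N -> #|{: 'I_d.-1.+1 * bool}| = (2 * d)%N.
Proof. by move=> d0; rewrite card_prod card_ord card_bool prednK// mulnC. Qed.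

End lattice.

Section potential.
Variables (R : realType) (d : nat).
Implicit Types (x y z : Zd d) (a : 'I_d.-1.+1 * bool).

(** As 16 |x| <= |x|^2 + 64, the constant 63 keeps the ratio
    2 |x| / (|x|^2 + 1 + 63) in the range of [inv4rt1D_le]. *)
Definition potential x : R := inv4rt ((sqnorm x)%:~R + 63).

Lemma sqnormR_ge0 x : 0 <= (sqnorm x)%:~R :> R.
Proof. by rewrite ler0z sqnorm_ge0. Qed.

Lemma potential_gt0 x : 0 < potential x.
Proof. by apply: inv4rt_gt0; have := sqnormR_ge0 x; lra. Qed.

(** With rho = |x|^2 + 64, a step in direction +-i changes |x|^2 + 63 to
    rho (1 +- t_i), where t_i = 2 x_i / rho.  Averaging [inv4rt1D_le] cancels the
    linear terms and leaves the factor 1 + (3/4d)|x|^2/rho^2, which is at most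
    1 + 1/(4 rho) as d >= 3; by [inv4rt_step_ge] this is compensated by passing
    from rho to rho - 1. *)
Lemma potential_superharmonic x : (2 < d)%N ->
  (2 * d)%:R^-1 * \sum_a potential (x + unit_step a) <= potential x.
Proof.
move=> d2; have d0 : (0 < d)%N by apply: leq_trans d2.
have dR : 3 <= d%:R :> R by rewrite ler_nat.
set s : R := (sqnorm x)%:~R; have s0 : 0 <= s := sqnormR_ge0 x.
pose rho := s + 64; have rho0 : 0 < rho by rewrite /rho; lra.
pose t a : R := 2 * (-1) ^+ a.2 * (x ord0 a.1)%:~R / rho.
have t2E a : t a ^+ 2 = 4 * ((x ord0 a.1)%:~R) ^+ 2 / rho ^+ 2.
  by rewrite /t; case: a.2; rewrite ?expr0 ?expr1; field; rewrite gt_eqF.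
have t8 a : - 8^-1 <= t a <= 8^-1.
  rewrite -ler_norml -(@ler_pXn2r _ 2)// ?nnegrE// real_normK ?num_real//.
  have xs : ((x ord0 a.1)%:~R : R) ^+ 2 <= s.
    by rewrite -rmorphXn/= ler_int sqnorm_coord.
  rewrite t2E ler_pdivrMr ?exprn_gt0//.
  apply: (@le_trans _ _ (4 * s)); first by rewrite ler_pM2l.
  by have := sqr_ge0 (s - 64); rewrite /rho !expr2; lra.
have step a : potential (x + unit_step a) <=
    inv4rt rho * (1 - t a / 4 + 3 / 16 * t a ^+ 2).
  rewrite /potential sqnorm_step.
  have -> : (sqnorm x + 1 + 2 * (-1) ^+ a.2 * x ord0 a.1)%:~R + 63 =
      rho * (1 + t a) :> R.
    rewrite mulrDr mulr1 [rho * t a]mulrC /t mulfVK ?gt_eqF// /rho.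
    rewrite !rmorphD !rmorphM/= rmorphXn/= rmorphN1 -/s; lra.
  by rewrite inv4rtM// ler_pM2l ?inv4rt_gt0// inv4rt1D_le.
rewrite ler_pdivrMl ?ltr0n ?muln_gt0//.
apply: (@le_trans _ _ (inv4rt rho * ((2 * d)%:R * (1 + rho^-1 / 4)))).
  apply: le_trans (ler_sum _ (fun a _ => step a)) _.
  rewrite -mulr_sumr ler_pM2l ?inv4rt_gt0//.
  rewrite -(pair_big xpredT xpredT
    (fun i b => 1 - t (i, b) / 4 + 3 / 16 * t (i, b) ^+ 2))/=.
  under eq_bigr => i _ do
    rewrite big_bool/= !t2E/= /t/= expr0 expr1 mulrN1 mulr1 !mulNr.
  apply: (@le_trans _ _ (\sum_(i < d.-1.+1)
     (2 + 3 / 2 / rho ^+ 2 * (x ord0 i ^+ 2)%:~R))).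
    by apply: ler_sum => i _; rewrite rmorphXn/=; lra.
  rewrite big_split/= sumr_const card_ord -mulr_sumr -rmorph_sum/= -/(sqnorm x) -/s.
  rewrite prednK// -[leLHS]/(2 *+ d + 3 / 2 / rho ^+ 2 * s).
  rewrite -[2 *+ d]mulr_natr natrM mulrDr mulr1 lerD2l.
  have -> : 3 / 2 / rho ^+ 2 * s = (2 * rho)^-1 * (3 * (s / rho)).
    by field; rewrite gt_eqF.
  have -> : 2 * d%:R * (rho^-1 / 4) = (2 * rho)^-1 * d%:R :> R.
    by field; rewrite gt_eqF.
  rewrite ler_pM2l ?invr_gt0 ?mulr_gt0//.
  have : s / rho <= 1 by rewrite ler_pdivrMr// /rho; lra.
  by lra.
rewrite mulrCA ler_pM2l ?ltr0n ?muln_gt0//.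
have -> : potential x = inv4rt rho * inv4rt (1 - rho^-1).
  rewrite -inv4rtM//; congr inv4rt.
  by rewrite mulrBr mulr1 divff ?gt_eqF// /rho -/s; lra.
rewrite ler_pM2l ?inv4rt_gt0// [rho^-1 / 4]mulrC mulrC.
apply: inv4rt_step_ge; rewrite invr_ge0 ltW//= invf_lt1//.
by rewrite /rho; lra.
Qed.

Lemma potential_step a : potential (unit_step a) = inv4rt 64.
Proof.
rewrite /potential -[unit_step a]add0r sqnorm_step sqnorm0 mxE mulr0 add0r addr0.
by congr inv4rt; lra.
Qed.

Lemma potential0_gt : inv4rt 64 < potential 0.
Proof. by apply: inv4rt_lt; rewrite /= sqnorm0; lra. Qed.

(** The constant 3 bounds the fourth root of 63. *)
Lemma potential_decay x (r : R) : 0 < r -> r ^+ 2 <= (sqnorm x)%:~R ->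
  potential x / potential 0 <= 3 / Num.sqrt r.
Proof.
move=> r0 rx; have s0 := sqnormR_ge0 x.
have sr : 0 < Num.sqrt r by rewrite sqrtr_gt0.
have p0 := potential_gt0 0; have px := potential_gt0 x.
rewrite -(@ler_pXn2r _ 4)// ?nnegrE; [|by rewrite divr_ge0 ?ltW..].
rewrite !expr_div_n !inv4rtX ?sqnorm0 ?add0r; [|lra..].
rewrite (exprM (Num.sqrt r) 2 2) sqr_sqrtr ?(ltW r0)// invrK mulrC.
have r2 : 0 < r ^+ 2 by rewrite exprn_gt0.
by apply: ler_pM; rewrite ?invr_ge0 ?lef_pV2 ?posrE//; lra.
Qed.

End potential.

(** * Probabilities that the walk avoids a set *)

Lemma measurable_countable_preimage dT (T : measurableType dT) (C : countType)
    (F : T -> C) (A : set C) :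
  (forall x, measurable [set t | F t = x]) -> measurable [set t | A (F t)].
Proof.
move=> mF; have -> : [set t | A (F t)] = \bigcup_x ([set t | F t = x /\ A x]).
  by apply/seteqP; split=> [t At|t [x _ [<-]]]//; exists (F t).
apply: countable_bigcupT_measurable => [|x]; first exact: countableP.
have [Ax|nAx] := pselect (A x).
  by rewrite (_ : mkset _ = [set t | F t = x])//; apply/seteqP; split=> t // [].
by rewrite (_ : mkset _ = set0)//; apply/seteqP; split=> t // [].
Qed.

Lemma measure_bigcup_fin dT (T : measurableType dT) (R : realType)
    (mu : {measure set T -> \bar R}) (I : finType) (F : I -> set T) :
  (forall i, measurable (F i)) -> trivIset setT F ->
  mu (\bigcup_i F i) = (\sum_i mu (F i))%E.
Proof.
move=> mF tF; rewrite measure_fin_bigcup//; last exact: finite_finset.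
rewrite (fsbigE (enum I)) ?enum_uniq// => [|i _]; last by rewrite mem_enum.
by rewrite big_enum_cond; apply: eq_bigl => i; rewrite in_setT.
Qed.

Section walk_avoidance.
Variables (R : realType) (d : nat).
Implicit Types (x : Zd d) (y : nat -> Zd d) (K : set (Zd d)).

(** The events whose probabilities [srw_law] prescribes. *)
Definition walk_prefix (m : nat) (y : nat -> Zd d) : set (walk d) :=
  [set w | forall i, (i <= m)%N -> w i = y i].

Definition walk_avoid (m n : nat) K : set (walk d) :=
  [set w | forall i, (m < i <= m + n)%N -> ~ K (w i)].

Fixpoint avoid_prob K (n : nat) x : R :=
  if n is n'.+1 then (2 * d)%:R^-1 *
    \sum_a (x + unit_step a \notin K)%:R * avoid_prob K n' (x + unit_step a)
  else 1.

Lemma measurable_walk_at (i : nat) K : measurable [set w : walk d | K (w i)].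
Proof.
apply: (measurable_countable_preimage (F := fun w : walk d => w i)) => x.
by apply: sub_sigma_algebra; exists i, x.
Qed.

Lemma measurable_forall_nat dT (T : measurableType dT) (D : set nat)
    (F : nat -> set T) : (forall i, measurable (F i)) ->
  measurable [set t | forall i, D i -> F i t].
Proof. by move=> mF; apply: (bigcap_measurableType (P := D)). Qed.

Lemma measurable_walk_prefix m y : measurable (walk_prefix m y).
Proof.
apply: (@measurable_forall_nat _ _ (fun i => (i <= m)%N)
  (fun i => [set w : walk d | w i = y i])).
by move=> i; exact: (measurable_walk_at i [set y i]).
Qed.

Lemma measurable_walk_avoid m n K : measurable (walk_avoid m n K).
Proof.
apply: (@measurable_forall_nat _ _ (fun i => (m < i <= m + n)%N)
  (fun i => [set w : walk d | ~ K (w i)])).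
by move=> i; exact: (measurable_walk_at i (~` K)).
Qed.

Lemma measurable_escape K : measurable (@escape d K).
Proof.
apply: (@measurable_forall_nat _ _ (fun i => (0 < i)%N)
  (fun i => [set w : walk d | ~ K (w i)])).
by move=> i; exact: (measurable_walk_at i (~` K)).
Qed.

Definition extend_path (y : nat -> Zd d) m a : nat -> Zd d :=
  fun i => if i == m.+1 then y m + unit_step a else y i.

Lemma walk_prefix_extend y m a : walk_prefix m.+1 (extend_path y m a) =
  walk_prefix m y `&` [set w | w m.+1 = y m + unit_step a].
Proof.
apply/seteqP; split=> [w H|w [H wm] i].
  split=> [i im|/=]; last by rewrite H// /extend_path eqxx.
  by rewrite H ?(leqW im)// /extend_path ltn_eqF// ltnS.
rewrite leq_eqVlt /extend_path; case: eqP => [->//|_ /=].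
by rewrite ltnS; exact: H.
Qed.

Section law.
Hypothesis d0 : (0 < d)%N.
Variables (x : Zd d) (P : probability (walk d) R).
Hypothesis hP : srw_law x P.

Lemma srw_law_extend y m a :
  P (walk_prefix m.+1 (extend_path y m a)) =
  ((2 * d)%:R^-1%:E * P (walk_prefix m y))%E.
Proof.
rewrite !hP big_ord_recr/= -EFinM; congr EFin.
rewrite /extend_path eqxx (ltn_eqF (ltnSn m)) /srw_step neighbors_step.
rewrite mulrA mulrC.
congr (_ * (_ * _)); apply: eq_bigr => i _.
by rewrite !ltn_eqF// ltnS // ltnW.
Qed.

(** The 2d extensions of a prefix by a unit step already carry the whole mass
    of the prefix, so what follows after any other step is negligible. *)
Lemma srw_law_split y m (D : set (walk d)) : measurable D ->
  P (walk_prefix m y `&` D) =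
  (\sum_a P (walk_prefix m.+1 (extend_path y m a) `&` D))%E.
Proof.
move=> mD; pose F a := walk_prefix m.+1 (extend_path y m a).
have mF a : measurable (F a) by exact: measurable_walk_prefix.
have tF : trivIset setT F.
  move=> a b _ _ [w []]; rewrite /F !walk_prefix_extend => -[_ /= ->] [_ /=].
  by move=> /addrI/unit_step_inj.
have sF : \bigcup_a F a `<=` walk_prefix m y.
  by move=> w [a _]; rewrite /F walk_prefix_extend => -[].
have mU : measurable (\bigcup_a F a).
  by apply: countable_bigcupT_measurable => // ; exact: countableP.
have null : P (walk_prefix m y `\` \bigcup_a F a) = 0%E.
  rewrite measureD//=; [|exact: measurable_walk_prefix|].
    rewrite setIC (setIidl sF) measure_bigcup_fin//.
    rewrite (eq_bigr _ (fun a _ => srw_law_extend y m a)).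
    rewrite !hP; under eq_bigr do rewrite -EFinM.
    rewrite sumEFin sumr_const (@card_unit_step d)// -[_ * _ *+ _]mulr_natl mulVKf.
      by rewrite -EFinB subrr.
    by rewrite pnatr_eq0 muln_eq0/= gtn_eqF.
  by rewrite ltey_eq fin_num_measure//; exact: measurable_walk_prefix.
rewrite -measure_bigcup_fin => [||a b _ _ [w [[Fa _] [Fb _]]]].
- have mC := measurable_walk_prefix m y.
  rewrite -setI_bigcupl.
  apply/eqP; rewrite eq_le; apply/andP; split; last first.
    by apply: le_measure; rewrite ?inE; [exact: measurableI..|exact: setSI].
  apply: (@le_trans _ _ (P ((\bigcup_a F a `&` D) `|`
      (walk_prefix m y `\` \bigcup_a F a)))).
    apply: le_measure; rewrite ?inE; first exact: measurableI.
      by apply: measurableU; [exact: measurableI|exact: measurableD].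
    move=> w [Cw Dw]; have [Fw|] := pselect ((\bigcup_a F a) w); first by left.
    by move=> nFw; right.
  apply: le_trans (measureU2 _ _ _) _; [exact: measurableI|exact: measurableD|].
  by rewrite [X in (_ + X)%E]null adde0.
- by move=> a; exact: measurableI (mF a) mD.
- by apply: (tF a b) => //; exists w.
Qed.

(** The Markov property at time m for avoidance events.  The induction is on
    the number n of steps that remain, for all prefixes at once. *)
Lemma walk_avoid_prefix n m y K :
  P (walk_prefix m y `&` walk_avoid m n K) =
  ((avoid_prob K n (y m))%:E * P (walk_prefix m y))%E.
Proof.
elim: n m y => [|n IH] m y.
  rewrite mul1e (_ : walk_avoid _ _ _ = setT) ?setIT//.
  apply/seteqP; split=> // w _ i /andP[mi]; rewrite addn0 => im.
  by move: (leq_trans mi im); rewrite ltnn.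
rewrite srw_law_split; last exact: measurable_walk_avoid.
rewrite (eq_bigr (fun a => (((2 * d)%:R^-1 * ((y m + unit_step a \notin K)%:R *
   avoid_prob K n (y m + unit_step a)))%:E * P (walk_prefix m y))%E)).
  by rewrite hP /= mulr_sumr !sumEFin -mulr_suml.
move=> a _; have [yK|yK] := pselect (K (y m + unit_step a)).
  rewrite mem_set//= mul0r mulr0 mul0e [X in P X](_ : _ = set0) ?measure0//.
  apply/seteqP; split=> // w; rewrite walk_prefix_extend => -[[_ /= wm] avd].
  by apply: (avd m.+1); rewrite ?wm// ltnSn/= addnS ltnS leq_addr.
rewrite memNset//= mul1r.
have -> : walk_prefix m.+1 (extend_path y m a) `&` walk_avoid m n.+1 K =
    walk_prefix m.+1 (extend_path y m a) `&` walk_avoid m.+1 n K.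
  apply/seteqP; split=> w [Cw avd]; split=> // i /andP[mi im].
    by apply: avd; rewrite (ltnW mi)/= addnS -addSn.
  move: mi; rewrite leq_eqVlt => /orP[/eqP <-|mi].
    by rewrite Cw// /extend_path eqxx.
  by apply: avd; rewrite mi/= addSn -addnS.
by rewrite IH srw_law_extend /extend_path eqxx !hP -!EFinM mulrA (mulrC _^-1).
Qed.

Lemma srw_avoid n K : P (walk_avoid 0 n K) = (avoid_prob K n x)%:E.
Proof.
have C1 : P (walk_prefix 0 (fun=> x)) = 1%E by rewrite hP eqxx big_ord0 mulr1.
have /= := walk_avoid_prefix n 0 (fun=> x) K; rewrite C1 mule1 => <-.
have mC := measurable_walk_prefix 0 (fun=> x); have mA := measurable_walk_avoid 0 n K.
apply/eqP; rewrite eq_le; apply/andP; split; last first.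
  by apply: le_measure; rewrite ?inE//; exact: measurableI.
apply: (@le_trans _ _ (P ((walk_prefix 0 (fun=> x) `&` walk_avoid 0 n K) `|`
    ~` walk_prefix 0 (fun=> x)))).
  apply: le_measure; rewrite ?inE//.
    by apply: measurableU; [exact: measurableI|exact: measurableC].
  by move=> w Aw; have [Cw|nCw] := pselect (walk_prefix 0 (fun=> x) w); [left|right].
apply: le_trans (measureU2 _ _ _) _; [exact: measurableI|exact: measurableC|].
by rewrite [X in (_ + X)%E]probability_setC// C1 subee// adde0.
Qed.

Lemma srw_escape_cvg K : (avoid_prob K n x)%:E @[n --> \oo] --> P (escape K).
Proof.
have -> : escape K = \bigcap_n walk_avoid 0 n K.
  apply/seteqP; split=> [w H n _ i /andP[i0 _]|w H n n0]; first exact: H.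
  by apply: (H n I); rewrite n0/= add0n.
under eq_fun do rewrite -srw_avoid.
apply: nonincreasing_cvg_mu.
- by rewrite ltey_eq fin_num_measure//; exact: measurable_walk_avoid.
- by move=> n; exact: measurable_walk_avoid.
- by apply: bigcapT_measurable => n; exact: measurable_walk_avoid.
- move=> m n mn; apply/subsetPset => w H i /andP[i0 im]; apply: H.
  by rewrite i0/= (leq_trans im)// leq_add2l.
Qed.

Lemma srw_escape_ge K (b : R) : (forall n, b <= avoid_prob K n x) ->
  b <= fine (P (escape K)).
Proof.
move=> H; rewrite -lee_fin fineK ?fin_num_measure//; last exact: measurable_escape.
rewrite -(cvg_lim _ (@srw_escape_cvg K))//; apply: lime_ge.
  by apply/cvg_ex; exists (P (escape K)); exact: srw_escape_cvg.
by apply: nearW => n; rewrite lee_fin.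
Qed.

End law.
End walk_avoidance.

(** * Escape probabilities *)

Section avoid_bounds.
Variables (R : realType) (d : nat).
Implicit Types (x y z : Zd d) (K : set (Zd d)).
Local Notation avoid_prob := (@avoid_prob R d).
Local Notation potential := (@potential R d).

Lemma avoid_prob_translate y n x z :
  avoid_prob [set y + z] n (x + z) = avoid_prob [set y] n x.
Proof.
elim: n x => [//|n IH] x /=; congr (_ * _); apply: eq_bigr => a _.
rewrite -[x + z + _]addrA [z + _]addrC addrA IH; congr (_ * _).
congr (nat_of_bool (~~ _))%:R; by rewrite !in_set1 (inj_eq (addIr z)).
Qed.

Hypothesis d2 : (2 < d)%N.

(** The potential centred at y, divided by its value at y, is superharmonic,
    nonnegative and equal to 1 at y, hence it dominates the probability of
    hitting y. *)
Lemma avoid_site_ge y n x :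
  1 - potential (x - y) / potential 0 <= avoid_prob [set y] n x.
Proof.
have p0 := potential_gt0 R (0 : Zd d).
have d0 : 0 < (2 * d)%:R :> R by rewrite ltr0n muln_gt0/= (leq_trans _ d2).
elim: n x => [|n IH] x /=.
  by rewrite gerBl divr_ge0 ?ltW ?potential_gt0.
have step a : 1 - potential (x + unit_step a - y) / potential 0 <=
    (x + unit_step a \notin [set y])%:R * avoid_prob [set y] n (x + unit_step a).
  have [/= xay|xay] := pselect (x + unit_step a = y).
    by rewrite mem_set//= mul0r xay subrr divff ?gt_eqF// subrr.
  by rewrite memNset//= mul1r.
rewrite ler_pdivlMl//; apply: le_trans (ler_sum _ (fun a _ => step a)).
rewrite sumrB sumr_const card_unit_step ?(leq_trans _ d2)// mulrBr mulr1.
have pi : 0 < (potential 0)^-1 by rewrite invr_gt0.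
rewrite lerD2l lerN2 -mulr_suml mulrA ler_pM2r//.
rewrite -ler_pdivrMl//.
under eq_bigr do rewrite addrAC.
exact: potential_superharmonic.
Qed.

(** After its first step the walk is at a neighbour of x, where the potential
    is strictly below its maximum. *)
Lemma avoid_self_ge n x : 1 - inv4rt 64 / potential 0 <= avoid_prob [set x] n x.
Proof.
have p0 := potential_gt0 R (0 : Zd d).
have d0 : 0 < (2 * d)%:R :> R by rewrite ltr0n muln_gt0/= (leq_trans _ d2).
have i64 : 0 < inv4rt 64 :> R by apply: inv4rt_gt0; lra.
case: n => [|n] /=; first by rewrite gerBl divr_ge0 ?ltW.
rewrite ler_pdivlMl//.
have step a : 1 - inv4rt 64 / potential 0 <=
    (x + unit_step a \notin [set x])%:R * avoid_prob [set x] n (x + unit_step a).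
  rewrite memNset/= ?mul1r => [|/eqP].
    have := avoid_site_ge x n (x + unit_step a).
    by rewrite addrAC subrr add0r potential_step.
  rewrite -subr_eq0 addrAC subrr add0r => /eqP /(congr1 (@sqnorm d)).
  by rewrite -[unit_step a]add0r sqnorm_step sqnorm0 mxE mulr0.
apply: le_trans (ler_sum _ (fun a _ => step a)).
by rewrite sumr_const card_unit_step ?(leq_trans _ d2)// mulr_natl.
Qed.

End avoid_bounds.

Section escape.
Variables (R : realType) (d : nat).
Hypothesis d2 : (2 < d)%N.
Variable P : Zd d -> probability (walk d) R.
Hypothesis hP : forall x, srw_law x (P x).
Implicit Types (x y z : Zd d) (K : set (Zd d)).

Let d0 : (0 < d)%N. Proof. exact: leq_trans d2. Qed.

Definition esc K x : R := fine (P x (escape K)).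

Lemma escE K x : P x (escape K) = (esc K x)%:E.
Proof. by rewrite fineK// fin_num_measure//; exact: measurable_escape. Qed.

Lemma esc_ge0 K x : 0 <= esc K x.
Proof. by rewrite fine_ge0. Qed.

Lemma esc_anti K K' x : K `<=` K' -> esc K' x <= esc K x.
Proof.
move=> KK; rewrite -lee_fin -!escE; apply: le_measure.
- by rewrite inE; exact: measurable_escape.
- by rewrite inE; exact: measurable_escape.
- by move=> w H n n0 /KK; exact: H.
Qed.

Lemma escape_setU K K' : @escape d (K `|` K') = escape K `&` escape K'.
Proof.
apply/seteqP; split=> [w H|w [H1 H2] n n0 []]; last 2 first.
- exact: H1.
- exact: H2.
by split=> n n0 Kw; apply: (H n n0); [left|right].
Qed.

(** A union bound: avoiding both sets fails only by hitting K' after all. *)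
Lemma esc_setU K K' x : esc K x - (1 - esc K' x) <= esc (K `|` K') x.
Proof.
have mK := measurable_escape K; have mK' := measurable_escape K'.
suff : (P x (escape K) <= P x (escape (K `|` K')) + (1 - P x (escape K')))%E.
  by rewrite !escE -EFinB -EFinD lee_fin lerBlDr.
rewrite -probability_setC//.
apply: le_trans (measureU2 _ _ _); [|exact: measurable_escape|exact: measurableC].
apply: le_measure; rewrite ?inE//.
  by apply: measurableU; [exact: measurable_escape|exact: measurableC].
rewrite escape_setU => w Kw.
by have [Kw'|] := pselect (escape K' w); [left|right].
Qed.

Definition site_cap : R := esc [set 0] 0.

Lemma esc_self x : esc [set x] x = site_cap.
Proof.
have cx := @srw_escape_cvg R d d0 _ _ (hP x) [set x].
have c0 := @srw_escape_cvg R d d0 _ _ (hP 0) [set 0].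
rewrite /site_cap /esc; congr fine.
apply: (@cvg_unique _ (@ereal_hausdorff R) _ _ _ _ cx).
rewrite (_ : (fun n => _) = fun n => (avoid_prob R [set 0] n (0 : Zd d))%:E)//.
apply/funext => n; congr EFin.
by rewrite -(avoid_prob_translate R 0 n 0 x) !add0r.
Qed.

Lemma esc_site_ge x y : 1 - potential R (x - y) / potential R (0 : Zd d) <= esc [set y] x.
Proof. by apply: (srw_escape_ge d0 (hP x)) => n; exact: avoid_site_ge. Qed.

Lemma site_cap_gt0 : 0 < site_cap.
Proof.
apply: (@lt_le_trans _ _ (1 - inv4rt 64 / potential R (0 : Zd d))).
  by rewrite subr_gt0 ltr_pdivrMr ?potential_gt0// mul1r potential0_gt.
by apply: (srw_escape_ge d0 (hP 0)) => n; exact: avoid_self_ge.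
Qed.

Lemma esc_pair_ge x y :
  site_cap - potential R (x - y) / potential R (0 : Zd d) <= esc [set x; y] x.
Proof.
apply: le_trans (esc_setU [set x] [set y] x).
by rewrite esc_self lerD2l lerN2; have := esc_site_ge x y; lra.
Qed.

End escape.

(** * Capacities of one and of two sites *)

Section entering.
Variable d : nat.
Implicit Types (x y z : Zd d) (K : set (Zd d)) (w : traj d).

Lemma measurable_at_time (n : int) K : measurable [set w | K (at_time w n)].
Proof.
apply: (measurable_countable_preimage (F := fun w : traj d => at_time w n)) => x.
by apply: sub_sigma_algebra; exists n, x.
Qed.

Lemma range_modshift w : range_mod (modshift w) = [set x | exists n, at_time w n = x].
Proof.
apply/seteqP; split=> [x [v /eqmodP/asboolP[N vw] [n <-]]|x [n wn]].
  by exists (n + N); rewrite vw.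
by exists w => //; exists n.
Qed.

Lemma entering_modshift K w :
  entering K (modshift w) <-> exists n, K (at_time w n).
Proof.
rewrite /entering /= range_modshift; split=> [[x Kx [n wn]]|[n Kn]].
  by exists n; rewrite wn.
by exists (at_time w n) => //; exists n.
Qed.

Lemma measurable_traj_exists K : measurable [set w : traj d | exists n, K (at_time w n)].
Proof.
rewrite (_ : mkset _ = \bigcup_n [set w | K (at_time w n)]).
  apply: countable_bigcupT_measurable => [|n]; first exact: countableP.
  exact: measurable_at_time.
by apply/seteqP; split=> w [n]; [exists n|move=> _; exists n].
Qed.

Lemma preimage_entering K : @modshift d @^-1` entering K =
  [set w | exists n, K (at_time w n)].
Proof. by apply/seteqP; split=> w /entering_modshift. Qed.

Lemma measurable_entering K : measurable (entering K).
Proof.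
rewrite /measurable /= /Wstar_measurable /image_set_system /= setTI.
by rewrite preimage_entering; exact: measurable_traj_exists.
Qed.

Lemma enteringU K K' : entering (K `|` K') = entering K `|` entering K'.
Proof.
apply/seteqP; split=> [w [x [Kx|Kx] wx]|w [[x Kx wx]|[x Kx wx]]].
- by left; exists x.
- by right; exists x.
- by exists x => //; left.
- by exists x => //; right.
Qed.

End entering.

Section capacity.
Variables (R : realType) (d : nat).
Hypothesis d2 : (2 < d)%N.
Variable P : Zd d -> probability (walk d) R.
Hypothesis hP : forall x, srw_law x (P x).
Variable nu : {sigma_finite_measure set (Wstar d) -> \bar R}.
Hypothesis hnu : interlacement_intensity P nu.
Implicit Types (x y z : Zd d) (K : set (Zd d)).

Local Notation esc := (esc P).
Local Notation c := (site_cap P).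

Lemma QK_start K (Q : set (traj d) -> \bar R) x : is_QK P K Q ->
  Q [set w | at_time w 0 = x] = (equilibrium P K x)%:E.
Proof.
move=> /(_ setT setT x measurableT measurableT).
rewrite setTI probability_setT/= mulr1.
rewrite (_ : mkset _ = [set w | at_time w 0 = x]) => [->|]; last first.
  by apply/seteqP; split=> w; [case|split].
congr EFin; rewrite /equilibrium -/(esc K x).
have [->|e0] := eqVneq (esc K x) 0; first by rewrite !mul0r.
by rewrite divff// mul1r.
Qed.

(** The total mass of Q_K is cap(K): trajectories are parametrised so that
    time 0 is in K, and the countably many starting points outside K are
    negligible. *)
Lemma nu_entering K : finite_set K ->
  nu (entering K) = (\sum_(x \in K) (equilibrium P K x)%:E)%E.
Proof.
move=> fK; have [Q HQ nuQ] := hnu fK.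
rewrite -[entering K]setTI nuQ// preimage_setT.
pose F x := [set w : traj d | at_time w 0 = x].
have mF x : measurable (F x) by exact: (measurable_at_time 0 [set x]).
have mK := measurable_at_time (d := d) 0 K.
have null : Q [set w | ~ K (at_time w 0)] = 0%E.
  have [f fE] : exists f : nat -> option (Zd d), forall x, exists n, f n = Some x.
    by exists (@unpickle (Zd d)) => x; exists (pickle x); rewrite pickleK.
  apply/eqP; rewrite eq_le measure_ge0 andbT.
  pose G n := if f n is Some x then [set w : traj d | at_time w 0 = x /\ ~ K x] else set0.
  have GN n : Q.-negligible (G n).
    rewrite /G; case: (f n) => [x|]; last exact: negligible_set0.
    have [Kx|nKx] := pselect (K x).
      rewrite (_ : mkset _ = set0); first exact: negligible_set0.
      by apply/seteqP; split=> w [].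
    apply: (@negligibleS _ _ _ _ (F x)); first by move=> w [].
    exists (F x); split=> //; apply: etrans (QK_start x HQ) _.
    by rewrite /equilibrium indicE memNset// mulr0.
  have [N [mN N0 sN]] := negligible_bigcup GN.
  rewrite -N0; apply: le_measure; rewrite ?inE//.
    exact: (measurable_at_time 0 (~` K)).
  move=> w Kw; apply: sN; have [n fn] := fE (at_time w 0).
  by exists n => //; rewrite /G fn.
transitivity (Q (\bigcup_(x in K) F x)); last first.
  rewrite measure_fin_bigcup//.
    by apply: eq_fsbigr => x _; exact: QK_start.
  by move=> x y _ _ [w [<- <-]].
have -> : \bigcup_(x in K) F x = [set w | K (at_time w 0)].
  by apply/seteqP; split=> [w [x Kx]|w Kw]; [rewrite /F/= => ->|exists (at_time w 0)].
rewrite -(setUv [set w : traj d | K (at_time w 0)]) measureU//.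
- by rewrite [X in (_ + X)%E](_ : _ = 0%E) ?adde0.
- exact: measurableC.
- by rewrite setICr.
Qed.

Lemma equilibriumE K x : K x -> equilibrium P K x = esc K x.
Proof. by move=> Kx; rewrite /equilibrium indicE mem_set// mulr1. Qed.

Lemma nu_site x : nu (entering [set x]) = c%:E.
Proof. by rewrite nu_entering// fsbig_set1 equilibriumE// esc_self. Qed.

Definition pair_cap x y : R := esc [set x; y] x + esc [set x; y] y.

Lemma nu_pair x y : x != y -> nu (entering [set x; y]) = (pair_cap x y)%:E.
Proof.
move=> /eqP xy; rewrite nu_entering//.
rewrite fsbigU0// => [|z [/= -> //]]; rewrite !fsbig_set1 !equilibriumE//.
- by right.
- by left.
Qed.

Lemma pair_capC x y : pair_cap x y = pair_cap y x.
Proof. by rewrite /pair_cap setUC addrC. Qed.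

Lemma pair_cap_far x y : 2 * c - potential R (x - y) / potential R (0 : Zd d) -
  potential R (y - x) / potential R (0 : Zd d) <= pair_cap x y.
Proof.
have := esc_pair_ge d2 hP x y; have := esc_pair_ge d2 hP y x.
by rewrite /pair_cap [[set y; x]]setUC; lra.
Qed.

(** Trajectories entering {x,y} split into those entering {y}, of measure c,
    and those visiting x but not y.  Seen from Q_{x}, the latter contain the
    paths at x at time 0 whose past and future avoid y; the past, conditioned
    not to return to x, and the future are independent. *)
Lemma pair_cap_ge_esc x y : x != y -> c + esc [set x; y] x ^+ 2 <= pair_cap x y.
Proof.
move=> xy; have [Q HQ nuQ] := hnu (finite_set1 x).
have mx := @measurable_entering d [set x].
have my := @measurable_entering d [set y].
have split2 : nu (entering [set x; y]) =
    (nu (entering [set y]) + nu (~` entering [set y] `&` entering [set x]))%E.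
  rewrite -measureU//; last 2 first.
    by apply: measurableI => //; exact: measurableC.
    by apply/seteqP; split=> w // [wy []].
  congr (nu _); rewrite enteringU; apply/seteqP; split=> w.
    by have [wy _|wy []] := pselect (entering [set y] w); [left|right|].
  by move=> [|[_]]; [right|left].
have : ((esc [set x; y] x ^+ 2)%:E <= nu (~` entering [set y] `&` entering [set x]))%E.
  rewrite nuQ; last exact: measurableC.
  have my' := @measurable_escape d [set y].
  apply: (@le_trans _ _ (Q [set w : traj d | [/\ escape [set y] (backward w),
       at_time w 0 = x & escape [set y] (forward w)]])).
    rewrite HQ// lee_fin -/(esc [set y] x) setIC -escape_setU equilibriumE//.
    rewrite -/(esc [set x] x) -/(esc [set x; y] x) mulfVK; last first.
      by rewrite gt_eqF// (esc_self d2 hP) site_cap_gt0.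
    rewrite expr2 ler_wpM2l ?esc_ge0//; apply: esc_anti => z ->; by right.
  have -> : [set w : traj d | [/\ escape [set y] (backward w),
      at_time w 0 = x & escape [set y] (forward w)]] =
      [set w | [set x] (at_time w 0)] `&`
      ~` [set w | exists n, [set y] (at_time w n)].
    apply/seteqP; split=> [w [Hb w0 Hf]|w [/= w0 wy]]; split=> //.
    - case=> -[[|m]|m] /= wm.
      + by move: xy; rewrite -w0 wm eqxx.
      + exact: (Hf m.+1).
      + by apply: (Hb m.+1) => //=; rewrite /backward -NegzE.
    - by move=> n _ wn; apply: wy; exists (- n%:Z).
    - by move=> n _ wn; apply: wy; exists n%:Z.
  apply: le_measure; rewrite ?inE.
  - apply: measurableI; first exact: measurable_at_time.
    by apply: measurableC; exact: measurable_traj_exists.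
  - rewrite -preimage_setC preimage_entering; apply: measurableC.
    exact: measurable_traj_exists.
  - by move=> w [_ wy] /=; rewrite entering_modshift.
move=> h; rewrite -lee_fin -nu_pair// split2 nu_site EFinD; exact: leeD2l.
Qed.

(** As e(x) + e(y) = cap{x,y} >= c, one of e(x) and e(y) is at least c/2. *)
Lemma pair_cap_near x y : x != y -> c + c ^+ 2 / 4 <= pair_cap x y.
Proof.
move=> xy; have c0 := site_cap_gt0 d2 hP.
have h1 := pair_cap_ge_esc xy.
have h2 : c + esc [set x; y] y ^+ 2 <= pair_cap x y.
  by rewrite pair_capC [[set x; y]]setUC pair_cap_ge_esc// eq_sym.
have e1 := esc_ge0 P [set x; y] x; have e2 := esc_ge0 P [set x; y] y.
have hc : c <= pair_cap x y by apply: le_trans h1; rewrite lerDl sqr_ge0.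
move: hc; rewrite {1}/pair_cap => hc.
by have [h|h] := lerP (c / 2) (esc [set x; y] x); nra.
Qed.

End capacity.

(** * Vacant sets and their probabilities *)

Section uncovered.
Variables (R : realType) (d : nat).
Variable nu : {sigma_finite_measure set (Wstar d) -> \bar R}.
Variables (dT : measure_display) (T : measurableType dT) (PP : probability T R).
Variable pts : nat -> T -> option (Wstar d * measurableTypeR R).
Hypothesis hpts : interlacement_process PP nu pts.
Implicit Types (x y z : Zd d) (K : set (Zd d)) (u : R).

Definition vacant u K : set T := [set t | forall x, K x -> ~ interlacement pts u t x].

Lemma point_measure_eq0 (dS : measure_display) (S : measurableType dS)
    (p : nat -> option S) (A : set S) :
  point_measure (R := R) p A = 0%E <-> forall i s, p i = Some s -> ~ A s.
Proof.
rewrite /point_measure.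
have F0 n : (0 <= (if p n is Some s then \d_s A else 0) :> \bar R)%E by case: (p n).
split=> [h i s pi As|h].
  have : (\sum_(0 <= i < i.+1) (if p i is Some s then \d_s A else 0) <= 0 :> \bar R)%E.
    by apply: le_trans (nneseries_lim_ge i.+1 _) _; [|rewrite h].
  rewrite leNgt => /negP; apply.
  rewrite big_nat_recr//= pi diracE mem_set//.
  by apply: lt_le_trans (leeDr _ _); [exact: lte01|exact: sume_ge0].
apply: eseries0 => n _ _; case pn: (p n) => [s|//].
by rewrite diracE memNset//; exact: h pn.
Qed.

(** The interlacement at level u misses K when no point of the process lies in
    the trajectories entering K times the levels up to u. *)
Lemma vacantE u K : vacant u K =
  [set t | point_measure (R := R) (pts ^~ t) (entering K `*` [set` `]-oo, u]%R]) = 0%E].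
Proof.
apply/seteqP; split=> t /=.
  move=> h; apply/point_measure_eq0 => i [ws v] pi [/= [x Kx wx]].
  by rewrite /= in_itv/= => vu; apply: (h x Kx); exists i, ws, v.
move=> /point_measure_eq0 h x Kx [i [ws [v [pi vu wx]]]].
by apply: (h _ _ pi); split => /=; [exists x|rewrite in_itv].
Qed.

Let mA u K : measurable (entering K `*` [set` `]-oo, u]%R] :
  set (Wstar d * measurableTypeR R)).
Proof.
by apply: measurableX; [exact: measurable_entering|exact: measurable_itv].
Qed.

Lemma measurable_vacant u K : measurable (vacant u K).
Proof.
rewrite vacantE; have [_ [mN _ _]] := hpts.
have := mN _ (mA u K) measurableT [set 0%E] (emeasurable_set1 _).
by rewrite setTI.
Qed.

Lemma prob_vacant u K (k : R) : 0 <= u -> nu (entering K) = k%:E ->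
  PP (vacant u K) = (expR (- (u * k)))%:E.
Proof.
move=> u0 nuK; have [_ [_ rv _]] := hpts.
have := rv _ (mA u K); rewrite (_ : (nu \x _)%E _ = (u * k)%:E).
  by move=> /(_ 0%N); rewrite vacantE expr0 fact0 invr1 mul1r mul1r.
rewrite (_ : _ `&` _ = entering K `*` [set` `[0, u]%R]).
  rewrite product_measure1E//; first last.
    exact: measurable_entering.
  rewrite /= lebesgue_measure_itv/= lte_fin nuK.
  move: u0; rewrite le_eqVlt => /orP[/eqP<-|u0].
    by rewrite ltxx mule0 mul0r.
  by rewrite u0 sube0 -EFinM mulrC.
apply/seteqP; split=> -[ws v] /=; rewrite !in_itv/=.
  by move=> [[? ->] ->].
by move=> [? /andP[-> ->]].
Qed.

End uncovered.

(** * Sites of the box and balls in it *)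

Section box_sites.
Variables (d l N : nat).
Hypothesis hl : (0 < l <= d)%N.
Implicit Types (phi psi : {ffun 'I_l -> 'I_N}).

(** Functions from 'I_l to 'I_N index the box by a finite type, for which
    cardinals and sums are available. *)
Definition site phi : Zd d :=
  \row_i (if insub (i : nat) is Some j then (phi j : nat)%:Z else 0).

Let ld : (l <= d.-1.+1)%N.
Proof. by case/andP: hl => l0 ld; rewrite prednK// (leq_trans l0). Qed.

Lemma site_coord phi (j : 'I_l) : site phi ord0 (widen_ord ld j) = (phi j : nat)%:Z.
Proof. by rewrite mxE/= valK. Qed.

Lemma site_inj : injective site.
Proof.
move=> phi psi e; apply/ffunP => j; apply/val_inj/eqP.
by rewrite -eqz_nat -!site_coord e.
Qed.

Lemma site_box phi : box l N (site phi).
Proof.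
move=> i; rewrite mxE; case: insubP => [j jl /= <-|/negbTE -> //].
by rewrite ltn_ord/= ltz_nat ltn_ord.
Qed.

Lemma box_site x : box l N x -> exists phi, x = site phi.
Proof.
move=> bx; have xb j : (`|x ord0 (widen_ord ld j)| < N)%N.
  have := bx (widen_ord ld j); rewrite /= ltn_ord => /andP[x0 xN].
  by rewrite -ltz_nat gez0_abs.
exists [ffun j => Ordinal (xb j)]; apply/rowP => i; rewrite mxE.
case: insubP => [j jl ji|il]; last first.
  by have := bx i; rewrite (negbTE il) => /eqP.
have -> : i = widen_ord ld j by apply/val_inj; rewrite /= ji.
rewrite ffunE/= gez0_abs//.
by have := bx (widen_ord ld j); rewrite /= ltn_ord => /andP[].
Qed.

Lemma card_near_nat (R : realType) (m : 'I_N) (rho : R) : 0 <= rho ->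
  #|[pred j : 'I_N | `|(m : nat)%:R - (j : nat)%:R| <= rho]|%:R <= 2 * rho + 1.
Proof.
move=> r0; set A := [pred j | _]; set r := Num.truncn rho.
have rr : r%:R <= rho by have := truncn_itv r0; rewrite -/r => /andP[].
apply: (@le_trans _ _ (2 * r + 1)%:R); last by rewrite natrD natrM lerD2r ler_pM2l.
(* The subtraction m - r is truncated; the 2r + 1 integers from m - r on still
   reach m + r in that case, as then m is at most r. *)
rewrite ler_nat cardE -(size_map val) -(size_iota (m - r) (2 * r + 1)).
apply: uniq_leq_size; first by rewrite map_inj_uniq ?enum_uniq//; exact: val_inj.
move=> _ /mapP[j + ->]; rewrite mem_enum inE /= => mj; rewrite mem_iota.
have h (a b : nat) : `|a%:R - b%:R| <= rho -> (a <= b + r)%N.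
  move=> ab; have [/ltnW ba|ba] := ltnP a b; first exact: leq_trans (leq_addr _ _).
  rewrite -(natrB _ ba) normr_nat in ab.
  by rewrite -leq_subLR truncn_ge_nat// ler_nat.
have := h _ _ mj; rewrite distrC in mj; have := h _ _ mj.
by lia.
Qed.

(** The ball is contained in a cube, whose cardinal is a product over the l
    coordinates. *)
Lemma card_near_site (R : realType) phi (rho : R) : 0 <= rho ->
  #|[pred psi | (sqnorm (site phi - site psi))%:~R <= rho ^+ 2]|%:R
    <= (2 * rho + 1) ^+ l.
Proof.
move=> r0.
pose F (j : 'I_l) := [pred k : 'I_N | `|(phi j : nat)%:R - (k : nat)%:R| <= rho].
apply: (@le_trans _ _ #|(family F : simpl_pred {ffun 'I_l -> 'I_N})|%:R).
  rewrite ler_nat; apply/subset_leq_card/fintype.subsetP => psi; rewrite !inE => h.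
  apply/familyP => j; rewrite inE.
  rewrite -(@ler_pXn2r _ 2)// ?nnegrE// real_normK ?num_real//.
  apply: le_trans h.
  have := sqnorm_coord (site phi - site psi) (widen_ord ld j).
  rewrite [X in X ^+ 2]mxE [X in _ + X]mxE !site_coord -(ler_int R) rmorphXn/= rmorphB/=.
  by [].
rewrite card_family foldrE big_map big_enum/= natr_prod.
apply: (@le_trans _ _ (\prod_(j < l) (2 * rho + 1))); last first.
  by rewrite prodr_const card_ord.
by apply: ler_prod => j _; rewrite ler0n/=; exact: card_near_nat.
Qed.

End box_sites.

(** * A second moment inequality *)

Section second_moment.
Context {R : realType} {dT : measure_display} {T : measurableType dT}.
Variable PP : probability T R.
Local Notation pr A := (fine (PP A)).

Lemma probE (A : set T) : measurable A -> PP A = (pr A)%:E.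
Proof. by move=> mA; rewrite fineK// fin_num_measure. Qed.

Lemma pr_ge0 (A : set T) : 0 <= pr A.
Proof. by rewrite fine_ge0. Qed.

Lemma integral_weighted (J : finType) (a : J -> R) (A : J -> set T) :
  (forall j, 0 <= a j) -> (forall j, measurable (A j)) ->
  (\int[PP]_t (\sum_j a j * \1_(A j) t)%:E = (\sum_j a j * pr (A j))%:E)%E.
Proof.
move=> a0 mA; under eq_integral do rewrite -sumEFin.
rewrite ge0_integral_sum//; last 2 first.
- by move=> j; apply/measurable_EFinP; exact: measurable_funM.
- by move=> j t _; rewrite lee_fin mulr_ge0.
rewrite -sumEFin; apply: eq_bigr => j _.
under eq_integral do rewrite EFinM.
rewrite ge0_integralZl_EFin//; last first.
  by apply/measurable_EFinP; exact: measurable_indic.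
by rewrite integral_indic// setIT EFinM -probE.
Qed.

(** The expectation of linear inequalities between indicators; keeping all
    weights nonnegative avoids integrability conditions. *)
Lemma le_weighted_prob (J K : finType) (a : J -> R) (A : J -> set T)
    (b : K -> R) (B : K -> set T) :
  (forall j, 0 <= a j) -> (forall j, measurable (A j)) ->
  (forall k, 0 <= b k) -> (forall k, measurable (B k)) ->
  (forall t, \sum_j a j * \1_(A j) t <= \sum_k b k * \1_(B k) t) ->
  \sum_j a j * pr (A j) <= \sum_k b k * pr (B k).
Proof.
move=> a0 mA b0 mB h; rewrite -lee_fin -!integral_weighted//.
have mf (I : finType) (e : I -> R) (E : I -> set T) : (forall i, measurable (E i)) ->
    measurable_fun setT (fun t => (\sum_i e i * \1_(E i) t)%:E).
  move=> mE; apply/measurable_EFinP; apply: measurable_sum => i.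
  by apply: measurable_funM => //; exact: measurable_indic.
apply: ge0_le_integral => //.
- by move=> t _; rewrite lee_fin sumr_ge0// => j _; rewrite mulr_ge0.
- exact: mf.
- exact: mf.
- by move=> t _; rewrite lee_fin.
Qed.

Lemma pr_union_bound (J : finType) (E : set T) (A : J -> set T) :
  measurable E -> (forall j, measurable (A j)) ->
  E `<=` \bigcup_j A j -> pr E <= \sum_j pr (A j).
Proof.
move=> mE mA sE.
have := @le_weighted_prob unit J (fun=> 1) (fun=> E) (fun=> 1) A.
rewrite big_const card_unit/= addr0 mul1r.
under eq_bigr do rewrite mul1r.
apply=> // t; rewrite big_const card_unit/= addr0 mul1r.
rewrite indicE; case: (boolP (t \in E)) => [/set_mem/sE[j _ Aj]|_]; last first.
  by rewrite sumr_ge0// => j _; rewrite mul1r.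
by rewrite (bigD1 j)//= mul1r indicE mem_set//= lerDl sumr_ge0.
Qed.

Variables (I : finType) (V : I -> set T).
Hypothesis mV : forall i, measurable (V i).

Definition occurrences (t : T) : nat := #|[pred i | `[< V i t >]]|.

Lemma occurrencesE t : (occurrences t)%:R = \sum_i \1_(V i) t :> R.
Proof.
rewrite /occurrences -sum1_card natr_sum big_mkcond/=; apply: eq_bigr => i _.
rewrite indicE inE; case: asboolP => H; first by rewrite mem_set.
by rewrite memNset.
Qed.

Lemma measurable_occurrences_lt (k : nat) : measurable [set t | (occurrences t < k)%N].
Proof.
have mf : measurable_fun setT (fun t => \sum_i (\1_(V i) t : R)).
  by apply: measurable_sum => i; exact: measurable_indic.
have := mf measurableT [set` `]-oo, (k%:R : R)[%R] (measurable_itv _).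
rewrite setTI (_ : _ @^-1` _ = [set t | (occurrences t < k)%N])//.
by apply/seteqP; split=> t /=; rewrite in_itv/= -occurrencesE ltr_nat.
Qed.

(** Chebyshev's inequality for the number Z of events that occur, with mean m.
    It is the expectation of
    (m - k)^2 1_{Z < k} + 2 m Z <= Z^2 + m^2,
    where Z^2 is the number of ordered pairs of events that both occur. *)
Lemma occurrences_second_moment (k : nat) : k%:R <= \sum_i pr (V i) ->
  (\sum_i pr (V i) - k%:R) ^+ 2 * pr [set t | (occurrences t < k)%N] <=
  \sum_i \sum_j pr (V i `&` V j) - (\sum_i pr (V i)) ^+ 2.
Proof.
set m := \sum_i pr (V i) => km.
have m0 : 0 <= m by apply: sumr_ge0 => i _; exact: pr_ge0.
pose a (o : unit + I) : R := if o is inr i then 2 * m else (m - k%:R) ^+ 2.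
pose A (o : unit + I) := if o is inr i then V i else [set t | (occurrences t < k)%N].
pose b (o : unit + I * I) : R := if o is inr _ then 1 else m ^+ 2.
pose B (o : unit + I * I) : set T := if o is inr ij then V ij.1 `&` V ij.2 else setT.
have : \sum_j a j * pr (A j) <= \sum_k b k * pr (B k).
  apply: le_weighted_prob.
  - by case=> [[]|i]/=; rewrite ?sqr_ge0// mulr_ge0.
  - by case=> [[]|i]//=; exact: measurable_occurrences_lt.
  - by case=> [[]|i]/=; rewrite ?sqr_ge0.
  - by case=> [[]|[i j]]//=; exact: measurableI.
  move=> t; rewrite !big_sumType/= !(big_const, card_unit)/= !addr0.
  rewrite -mulr_sumr -occurrencesE indicT mulr1.
  rewrite -(pair_big xpredT xpredT (fun i j => 1 * \1_(V i `&` V j) t))/=.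
  have -> : \sum_i \sum_j 1 * \1_(V i `&` V j) t = (occurrences t)%:R ^+ 2 :> R.
    rewrite occurrencesE expr2 mulr_suml; apply: eq_bigr => i _.
    by rewrite mulr_sumr; apply: eq_bigr => j _; rewrite mul1r indicI.
  have : (m - k%:R) ^+ 2 * \1_[set t | (occurrences t < k)%N] t <=
      (m - (occurrences t)%:R) ^+ 2.
    rewrite indicE; case: (boolP (_ \in _)) => [/set_mem/= zk|_]; last first.
      by rewrite mulr0 sqr_ge0.
    rewrite mulr1 ler_sqr ?nnegrE ?subr_ge0//.
      by rewrite lerD2l lerN2 ler_nat ltnW.
    by apply: le_trans km; rewrite ler_nat ltnW.
  by rewrite sqrrB; lra.
rewrite !big_sumType/= !(big_const, card_unit)/= !addr0.
rewrite probability_setT/= mulr1 -mulr_sumr -/m.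
rewrite -(pair_big xpredT xpredT (fun i j => 1 * pr (V i `&` V j)))/=.
under [X in _ <= _ + X]eq_bigr => i _ do under eq_bigr => j _ do rewrite mul1r.
lra.
Qed.

End second_moment.

(** * From the order of covering to vacant sites *)

Section late_sites.
Variables (R : realType) (d l N : nat).
Hypothesis hl : (0 < l <= d)%N.
Variables (dT : measure_display) (T : measurableType dT) (PP : probability T R).
Variable pts : nat -> T -> option (Wstar d * measurableTypeR R).
Variables (X : nat -> T -> Zd d) (k : nat).
Hypothesis hX : cover_ordering pts (box l N) (N ^ l) X.
Hypothesis kn : (k <= N ^ l)%N.
Local Notation I := {ffun 'I_l -> 'I_N}.
Local Notation site := (@site d l N).

Definition close_pair (rho : R) : set T :=
  [set t | exists i j, [/\ (1 <= i)%N, (i < j)%N, (j <= k)%N &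
                enorm R (X i t - X j t) <= rho]].

Definition close_sites (rho : R) (p : I * I) : bool :=
  (p.1 != p.2) && ((sqnorm (site p.1 - site p.2))%:~R <= rho ^+ 2).

Definition vacant_sites (u : R) : T -> nat :=
  occurrences (fun phi : I => vacant pts u [set site phi]).

(** The random sites take countably many values, so the event is a countable
    union over the two indices and the value of the first site. *)
Lemma measurable_close_pair rho : measurable (close_pair rho).
Proof.
have [mX _ _] := hX.
pose F (ij : nat * nat) := [set t | [/\ (1 <= ij.1)%N, (ij.1 < ij.2)%N,
  (ij.2 <= k)%N & enorm R (X ij.1 t - X ij.2 t) <= rho]].
rewrite (_ : close_pair rho = \bigcup_ij F ij); last first.
  by apply/seteqP; split=> t [i]; [move=> [j H]; exists (i, j)|exists i.1, i.2].
apply: countable_bigcupT_measurable => [|[i j]]; first exact: countableP.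
have [ij|nij] := boolP ((1 <= i) && (i < j <= k))%N; last first.
  rewrite (_ : F _ = set0) => [|]; first exact: measurable0.
  by apply/seteqP; split=> t // [/= i1 ij jk _]; rewrite i1 ij jk in nij.
have /andP[i1 /andP[ij' jk]] := ij.
have iN : (i <= N ^ l)%N by rewrite (leq_trans _ kn)// (leq_trans (ltnW ij')).
have jN : (j <= N ^ l)%N by rewrite (leq_trans jk).
have j1 : (1 <= j)%N by rewrite (leq_trans i1)// ltnW.
rewrite (_ : F _ = \bigcup_a ([set t | X i t = a] `&`
    [set t | [set b | enorm R (a - b) <= rho] (X j t)])).
  apply: countable_bigcupT_measurable => [|a]; first exact: countableP.
  apply: measurableI; first by apply: mX; rewrite i1.
  by apply: measurable_countable_preimage => x; apply: mX; rewrite j1.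
apply/seteqP; split=> t; first by move=> [/= _ _ _ H]; exists (X i t).
by move=> [a _ [/= <- H]]; split.
Qed.

(** If the i-th site were covered by level v < u, so would be all sites that
    come after it in the order, and only the i - 1 < k sites before it could be
    vacant at level u. *)
Lemma late_sites_vacant (u v : R) t : 0 <= v -> v < u ->
  (k <= vacant_sites u t)%N ->
  forall i, (1 <= i <= k)%N -> ~ interlacement pts v t (X i t).
Proof.
move=> v0 vu kz i /andP[i1 ik] Xi; have [_ bij ord] := hX.
have [_ _ surj] := bij t.
have Ui : (cover_level_site pts t (X i t) <= v%:E)%E.
  by apply: ereal_inf_lbound; exists v.
(* A site vacant at level u has cover level at least u, hence it comes strictly
   before the i-th one. *)
have sub : {subset [seq site phi |
      phi <- enum [pred phi : I | `[< vacant pts u [set site phi] t >]]]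
    <= [seq X j t | j <- iota 1 i.-1]}.
  move=> _ /mapP[phi + ->]; rewrite mem_enum => /asboolP vphi.
  have [j /= /andP[j1 jN] Xj] := surj _ (@site_box d l N phi).
  rewrite -Xj; apply/map_f; rewrite mem_iota j1/= add1n prednK//.
  rewrite ltnNge; apply/negP => ij.
  have := le_trans (ord t i j i1 ij jN) Ui; rewrite Xj leNgt => /negP; apply.
  apply: (@lt_le_trans _ _ u%:E); first by rewrite lte_fin.
  apply: le_ereal_inf_tmp => _ [w [w0 Iw] <-]; rewrite lee_fin leNgt.
  apply/negP => /ltW wu; apply: (vphi (site phi)) => //.
  exact: interlacement_mono wu _ Iw.
have := uniq_leq_size _ sub; rewrite map_inj_uniq; last exact: site_inj hl.
rewrite enum_uniq !size_map size_iota -cardE => /(_ isT).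
by move/(leq_trans kz)/(leq_trans ik); rewrite leqNgt ltn_predL i1.
Qed.

Lemma close_pair_sub (u v rho : R) : 0 <= v -> v < u -> 0 <= rho ->
  close_pair rho `<=` [set t | (vacant_sites u t < k)%N] `|`
   \bigcup_p (if close_sites rho p then vacant pts v [set site p.1; site p.2] else set0).
Proof.
move=> v0 vu r0 t [i [j [i1 ij jk Xij]]].
have [zk|kz] := ltnP (vacant_sites u t) k; [by left|right].
have [_ bij _] := hX; have [fb inj _] := bij t.
have ik : (i <= k)%N by rewrite (leq_trans (ltnW ij)).
have j1 : (1 <= j)%N by rewrite (leq_trans i1)// ltnW.
have vac := late_sites_vacant v0 vu kz.
have [|phi Ephi] := box_site hl (fb i _); first by rewrite /= i1 (leq_trans ik).
have [|psi Epsi] := box_site hl (fb j _); first by rewrite /= j1 (leq_trans jk).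
exists (phi, psi) => //; rewrite /close_sites /= ifT.
  by move=> x [|] /= ->; rewrite -?Ephi -?Epsi; apply: vac; rewrite ?i1 ?j1.
apply/andP; split.
  apply/eqP => pp; move: ij; rewrite (inj i j) ?ltnn ?inE/= ?i1 ?j1
    ?(leq_trans ik) ?(leq_trans jk)//.
  by rewrite Ephi Epsi pp.
rewrite -Ephi -Epsi -[X in X <= _](@sqr_sqrtr R) ?sqnormR_ge0//.
by rewrite ler_sqr ?nnegrE ?sqrtr_ge0.
Qed.

End late_sites.

(** * Sums over pairs of sites of the box *)

Lemma natr_card (R : nzRingType) (I : finType) (p : pred I) :
  #|p|%:R = \sum_i (p i)%:R :> R.
Proof.
rewrite -sum1_card natr_sum big_mkcond/=; apply: eq_bigr => i _.
by rewrite unfold_in; case: (p i).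
Qed.

Section box_estimate.
Variables (R : realType) (d l N : nat).
Hypothesis d2 : (2 < d)%N.
Hypothesis hl : (0 < l <= d)%N.
Variable P : Zd d -> probability (walk d) R.
Hypothesis hP : forall x, srw_law x (P x).
Variable nu : {sigma_finite_measure set (Wstar d) -> \bar R}.
Hypothesis hnu : interlacement_intensity P nu.
Variables (dT : measure_display) (T : measurableType dT) (PP : probability T R).
Variable pts : nat -> T -> option (Wstar d * measurableTypeR R).
Hypothesis hpts : interlacement_process PP nu pts.
Local Notation I := {ffun 'I_l -> 'I_N}.
Local Notation site := (@site d l N).
Local Notation c := (site_cap P).
Local Notation pr A := (fine (PP A)).
Local Notation n := ((N ^ l)%:R : R).
Implicit Types (phi psi : I) (u v : R).

Lemma pr_vacant1 u phi : 0 <= u ->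
  pr (vacant pts u [set site phi]) = expR (- (u * c)).
Proof. by move=> u0; rewrite (prob_vacant hpts u0 (nu_site d2 hP hnu _)). Qed.

Lemma pr_vacant2 u phi psi : 0 <= u -> phi != psi ->
  pr (vacant pts u [set site phi; site psi]) =
  expR (- (u * pair_cap P (site phi) (site psi))).
Proof.
move=> u0 pp; rewrite (prob_vacant hpts u0 (nu_pair hnu _))//.
by apply: contra pp => /eqP/(site_inj hl) ->.
Qed.

Variables (u Lam : R).
Hypothesis u0 : 0 <= u.
Hypothesis Lam0 : 0 < Lam.

Let A := expR (- (u * (c + c ^+ 2 / 4))).
Let B := expR (- (u * (2 * c - 2 * (3 / Num.sqrt Lam)))).

(** The indicator selects the pairs at distance at most Lam, for which
    [pair_cap_near] is used; [pair_cap_far] serves for the others. *)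
Lemma pr_vacant2_le phi psi : phi != psi ->
  pr (vacant pts u [set site phi; site psi]) <=
  ((sqnorm (site phi - site psi))%:~R <= Lam ^+ 2)%R%:R * A + B.
Proof.
move=> pp; have xy : site phi != site psi.
  by apply: contra pp => /eqP/(site_inj hl) ->.
rewrite pr_vacant2//.
have [near|far] := lerP (sqnorm (site phi - site psi))%:~R (Lam ^+ 2).
  rewrite mul1r; apply: (@le_trans _ _ A); last by rewrite lerDl expR_ge0.
  by rewrite ler_expR lerN2 ler_wpM2l// (pair_cap_near d2 hP hnu).
rewrite mul0r add0r ler_expR lerN2 ler_wpM2l//.
have := pair_cap_far d2 hP (site phi) (site psi).
have := potential_decay Lam0 (ltW far).
have := @potential_decay R d (site psi - site phi) Lam Lam0.
by rewrite -opprB sqnormN => /(_ (ltW far)); lra.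
Qed.

(** D restricts the pairs: to all pairs for the second moment, and to pairs at
    distance at most delta N for the first moment of close pairs. *)
Lemma pair_sum_le (D : I -> pred I) (M : R) :
  (forall phi, #|D phi|%:R <= M) ->
  \sum_phi \sum_(psi | (phi != psi) && D phi psi)
    pr (vacant pts u [set site phi; site psi])
  <= n * ((2 * Lam + 1) ^+ l * A + M * B).
Proof.
move=> DM; apply: (@le_trans _ _ (\sum_phi ((2 * Lam + 1) ^+ l * A + M * B))).
  apply: ler_sum => phi _.
  apply: (@le_trans _ _ (\sum_psi
     (((sqnorm (site phi - site psi))%:~R <= Lam ^+ 2)%R%:R * A + (D phi psi)%:R * B))).
    rewrite big_mkcond/=; apply: ler_sum => psi _.
    case: ifP => [/andP[pp ->]|_]; first by rewrite mul1r pr_vacant2_le.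
    by rewrite addr_ge0// mulr_ge0// expR_ge0.
  rewrite big_split/= -!mulr_suml lerD// ler_wpM2r ?expR_ge0//.
    apply: le_trans (card_near_site hl phi (ltW Lam0)).
    by rewrite natr_card.
  by apply: le_trans (DM phi); rewrite natr_card.
by rewrite sumr_const card_ffun !card_ord -[leLHS]mulr_natl.
Qed.

Lemma vacant_pair phi psi : vacant pts u [set site phi] `&` vacant pts u [set site psi] =
  vacant pts u [set site phi; site psi].
Proof.
apply/seteqP; split=> t; first by move=> [h1 h2] x []; [exact: h1|exact: h2].
by move=> h; split=> [x xs|x xs]; [apply: h; left|apply: h; right].
Qed.

Lemma few_vacant_le (k : nat) : let m := n * expR (- (u * c)) in
  k%:R <= m ->
  (m - k%:R) ^+ 2 * pr [set t | (vacant_sites l N pts u t < k)%N] <=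
  m + n * ((2 * Lam + 1) ^+ l * A + n * B) - m ^+ 2.
Proof.
move=> m km; have sE : \sum_phi pr (vacant pts u [set site phi]) = m.
  under eq_bigr do rewrite pr_vacant1//.
  by rewrite sumr_const card_ffun !card_ord /m mulr_natl.
have mV phi : measurable (vacant pts u [set site phi]) by exact: (measurable_vacant hpts).
have := occurrences_second_moment (PP := PP) mV (k := k).
rewrite sE => /(_ km) /le_trans; apply; rewrite lerD2r.
have -> : m = \sum_phi pr (vacant pts u [set site phi]) by [].
apply: (@le_trans _ _ (\sum_phi (pr (vacant pts u [set site phi]) +
   \sum_(psi | (phi != psi) && xpredT psi) pr (vacant pts u [set site phi; site psi])))).
  apply: ler_sum => phi _; rewrite (bigD1 phi)//= setIid lerD2l le_eqVlt.
  apply/orP; left; apply/eqP; apply: eq_big => psi; first by rewrite eq_sym andbT.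
  by move=> _; rewrite vacant_pair.
rewrite big_split/= lerD2l; apply: pair_sum_le => phi.
by rewrite cardT -cardE card_ffun !card_ord.
Qed.

Lemma close_vacant_le (rho : R) : 0 <= rho ->
  \sum_p pr (if close_sites d rho p then
    vacant pts u [set site p.1; site p.2] else set0) <=
  n * ((2 * Lam + 1) ^+ l * A + (2 * rho + 1) ^+ l * B).
Proof.
move=> r0; apply: le_trans (pair_sum_le (fun phi => card_near_site hl phi r0)).
rewrite -(pair_big xpredT xpredT (fun phi psi => pr (if close_sites d rho (phi, psi) then
   vacant pts u [set site phi; site psi] else set0)))/=.
apply: ler_sum => phi _; rewrite [leRHS]big_mkcond/=; apply: ler_sum => psi _.
by rewrite /close_sites/=; case: ifP => // _; rewrite measure0.
Qed.

End box_estimate.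

(** * Limits *)

Section asymptotics.
Variable R : realType.
Implicit Types (a c e s y K : R).

(** Here y = log N, n = e^(ly), the level is (ly - s)/c and the threshold
    distance is N^(c/8).  The gain n^(-c/4) of a pair over n^(-1) beats the
    number 3^l n^(c/8) of sites near a given one. *)
Lemma near_pair_term (l : nat) c s y : (0 < l)%N -> 0 < c -> 0 <= y ->
  expR (l%:R * y) * ((2 * expR (c / 8 * y) + 1) ^+ l *
    expR (- ((l%:R * y - s) / c * (c + c ^+ 2 / 4)))) <=
  3 ^+ l * expR (s * (1 + c / 4)) * expR (- (c / 8 * y)).
Proof.
move=> l0 c0 y0.
have E1 : 1 <= expR (c / 8 * y).
  by rewrite -[leLHS]expR0 ler_expR !mulr_ge0 ?invr_ge0// ltW.
have h : (2 * expR (c / 8 * y) + 1) ^+ l <= 3 ^+ l * expR (l%:R * (c / 8 * y)).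
  rewrite expRM_natl -exprMn lerXn2r ?nnegrE//; lra.
apply: (@le_trans _ _ (expR (l%:R * y) * (3 ^+ l * expR (l%:R * (c / 8 * y)) *
    expR (- ((l%:R * y - s) / c * (c + c ^+ 2 / 4)))))).
  by rewrite ler_pM2l ?expR_gt0// ler_pM2r ?expR_gt0.
rewrite -[in leLHS]mulrA mulrCA -[leRHS]mulrA ler_pM2l ?exprn_gt0//.
rewrite -!expRD ler_expR.
have -> : (l%:R * y - s) / c * (c + c ^+ 2 / 4) = (l%:R * y - s) * (1 + c / 4).
  by field; rewrite gt_eqF.
have : c / 8 * y <= l%:R * (c / 8 * y).
  by rewrite ler_peMl ?ler1n// !mulr_ge0 ?invr_ge0// ltW.
lra.
Qed.

Lemma sqrt_expR (x : R) : Num.sqrt (expR x) = expR (x / 2).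
Proof.
have -> : expR x = expR (x / 2) ^+ 2 by rewrite -expRM_natl; congr expR; lra.
by rewrite sqrtr_sqr ger0_norm// expR_ge0.
Qed.

(** Same parameters: n^2 times the bound on the probability of a far pair
    is e^(2s) up to a factor that tends to 1 as y tends to infinity. *)
Lemma far_pair_term (l : nat) c s y : 0 < c -> 0 <= s -> 0 <= y ->
  expR (l%:R * y) ^+ 2 * expR (- ((l%:R * y - s) / c *
    (2 * c - 2 * (3 / Num.sqrt (expR (c / 8 * y)))))) <=
  expR (2 * s) * expR (6 * l%:R / c * (y * expR (- (c / 16 * y)))).
Proof.
move=> c0 s0 y0; rewrite sqrt_expR -expRM_natl -!expRD ler_expR.
rewrite -expRN.
have -> : - (c / 8 * y / 2) = - (c / 16 * y) by lra.
set E := expR _; have E0 : 0 <= E by exact: expR_ge0.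
have -> : (l%:R * y - s) / c * (2 * c - 2 * (3 * E)) =
   2 * (l%:R * y - s) - 6 * l%:R / c * (y * E) + 6 * (s / c * E).
  by field; rewrite gt_eqF.
have : 0 <= s / c * E by rewrite !mulr_ge0 ?invr_ge0// ltW.
lra.
Qed.

Lemma expRN_eventually a K e : 0 < a -> 0 < e ->
  exists Y, forall y, Y <= y -> K * expR (- (a * y)) <= e.
Proof.
move=> a0 e0; exists (`|K| / (a * e)) => y Yy.
rewrite expRN ler_pdivrMr ?expR_gt0//.
apply: (@le_trans _ _ (e * (a * y))).
  apply: (le_trans (ler_norm K)); rewrite mulrCA mulrA -ler_pdivrMl ?mulr_gt0//.
  by rewrite mulrC.
by rewrite ler_pM2l//; apply: le_trans (expR_ge1Dx _); rewrite lerDr.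
Qed.

Lemma mulr_expRN_eventually a K e : 0 < a -> 0 < e ->
  exists Y, forall y, Y <= y -> K * (y * expR (- (a * y))) <= e.
Proof.
move=> a0 e0.
have a20 : 0 < a / 2 by lra.
have [Y hY] := expRN_eventually (`|K| * (2 / a)) a20 e0.
exists (Num.max Y 0) => y; rewrite ge_max => /andP[Yy y0].
apply: le_trans (hY _ Yy); rewrite -[leRHS]mulrA.
apply: (@le_trans _ _ (`|K| * (y * expR (- (a * y))))).
  by rewrite ler_wpM2r ?ler_norm// mulr_ge0 ?expR_ge0.
rewrite ler_wpM2l//.
have -> : expR (- (a * y)) = expR (- (a / 2 * y)) * expR (- (a / 2 * y)).
  by rewrite -expRD; congr expR; lra.
rewrite mulrA ler_pM2r ?expR_gt0// expRN ler_pdivrMr ?expR_gt0//.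
have := expR_ge1Dx (a / 2 * y).
set E := expR _ => h; apply: (@le_trans _ _ (2 / a * (a / 2 * y))).
  by rewrite mulrA (_ : 2 / a * (a / 2) = 1) ?mul1r//; field; rewrite gt_eqF.
by rewrite ler_pM2l ?divr_gt0//; lra.
Qed.

Lemma near_ln_nat (Q : R -> Prop) : (exists Y, forall y, Y <= y -> Q y) ->
  \forall N \near \oo, Q (ln (N%:R : R)).
Proof.
move=> [Y hY]; near=> N; apply: hY.
rewrite -[Y]expRK ler_ln ?posrE ?expR_gt0//.
  by near: N; exact: nbhs_infty_ger.
by rewrite ltr0n; near: N; exact: nbhs_infty_gt.
Unshelve. all: by end_near. Qed.

Lemma limn_esup_le_near (u : (\bar R)^nat) (b : \bar R) :
  (\forall n \near \oo, u n <= b)%E -> (limn_esup u <= b)%E.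
Proof.
move=> ub; apply: (@le_trans _ _ (ereal_sup (u @` [set n | (u n <= b)%E]))).
  by apply: ereal_inf_lbound; exists [set n | (u n <= b)%E].
by apply: ge_ereal_sup => _ [n /= un <-].
Qed.

Lemma limn_esup_ge0 (u : (\bar R)^nat) :
  (forall n, 0 <= u n)%E -> (0 <= limn_esup u)%E.
Proof.
move=> u0; rewrite limn_esup_lim; apply: lime_ge; first exact: is_cvg_esups.
apply: nearW => n; apply: le_trans (u0 n) _.
by apply: ereal_sup_ubound; exists n => //=.
Qed.

Lemma cvg_ereal_small (f : R -> \bar R) : (forall x, 0 <= f x)%E ->
  (forall e, 0 < e -> \forall x \near 0^'+, (f x <= e%:E)%E) ->
  f x @[x --> 0^'+] --> 0%E.
Proof.
move=> f0 fe A [e /= e0 Ae].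
have e20 : 0 < e / 2 by rewrite divr_gt0.
apply: filterS (fe _ e20) => x /= fx.
have fxr : f x \is a fin_num.
  by rewrite ge0_fin_numE// (le_lt_trans fx)// ltry.
rewrite -(fineK fxr); apply: Ae => /=.
rewrite sub0r normrN ger0_norm ?fine_ge0//.
by rewrite -lte_fin fineK// (le_lt_trans fx)// lte_fin; lra.
Qed.

End asymptotics.

(** * Last sites to be covered *)

(** Here S = e^s is the expected number of vacant sites, kap bounds the
    contribution of near pairs and 1 + theta the correction factor of far
    pairs.  The terms of order 1/S, kap and theta are at most e/4, e/5 and e/4
    after division by (S - k)^2 >= S^2/4. *)
Lemma few_vacant_arith (R : realFieldType) (S k kap theta e p : R) :
  0 < e -> 1 <= S -> 16 / e <= S -> 2 * k <= S ->
  kap <= e / 20 -> 0 <= theta -> theta <= e / 16 -> 0 <= p ->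
  (S - k) ^+ 2 * p <= S + (kap + S ^+ 2 * (1 + theta)) - S ^+ 2 ->
  p <= e * (7 / 10).
Proof.
move=> e0 S1 Se Sk ke t0 te p0 h.
have S2 : 0 < S ^+ 2 by rewrite exprn_gt0//; lra.
have h1 : S ^+ 2 / 4 * p <= S + kap + S ^+ 2 * theta.
  apply: (@le_trans _ _ ((S - k) ^+ 2 * p)); last by lra.
  by rewrite ler_wpM2r//; nra.
have h2 : S <= S ^+ 2 * (e / 16).
  have : 1 <= S * (e / 16).
    by move: Se; rewrite ler_pdivrMr//; lra.
  nra.
have h3 : kap <= S ^+ 2 * (e / 20).
  apply: le_trans ke _; rewrite ler_peMl ?divr_ge0 ?(ltW e0)// expr2.
  by rewrite mulr_ege1.
have h4 : S ^+ 2 * theta <= S ^+ 2 * (e / 16) by rewrite ler_pM2l.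
rewrite -(ler_pM2l S2); lra.
Qed.

Section assembly.
Variables (R : realType) (d l N : nat).
Hypothesis d2 : (2 < d)%N.
Hypothesis hl : (0 < l <= d)%N.
Variable P : Zd d -> probability (walk d) R.
Hypothesis hP : forall x, srw_law x (P x).
Variable nu : {sigma_finite_measure set (Wstar d) -> \bar R}.
Hypothesis hnu : interlacement_intensity P nu.
Variables (dT : measure_display) (T : measurableType dT) (PP : probability T R).
Variable pts : nat -> T -> option (Wstar d * measurableTypeR R).
Hypothesis hpts : interlacement_process PP nu pts.
Variables (X : nat -> T -> Zd d) (k : nat).
Hypothesis hX : cover_ordering pts (box l N) (N ^ l) X.
Hypothesis kn : (k <= N ^ l)%N.
Local Notation I := {ffun 'I_l -> 'I_N}.
Local Notation site := (@site d l N).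
Local Notation c := (site_cap P).
Local Notation pr A := (fine (PP A)).
Local Notation n := ((N ^ l)%:R : R).
Local Notation y := (ln (N%:R : R)).

(** Either fewer than k sites are vacant at level u, or the first k sites are
    all vacant at the lower level v. *)
Lemma pr_close_pair_le (u v rho : R) : 0 <= v -> v < u -> 0 <= rho ->
  pr (close_pair X k rho) <= pr [set t | (vacant_sites l N pts u t < k)%N] +
    \sum_p pr (if close_sites d rho p then
      vacant pts v [set site p.1; site p.2] else set0).
Proof.
move=> v0 vu r0.
pose A (o : unit + I * I) := if o is inr p then
   (if close_sites d rho p then vacant pts v [set site p.1; site p.2] else set0)
  else [set t | (vacant_sites l N pts u t < k)%N].
have mA o : measurable (A o).
  case: o => [_|p] /=; last by case: ifP => // _; exact: (measurable_vacant hpts).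
  by apply: (@measurable_occurrences_lt R) => phi; exact: (measurable_vacant hpts).
have := pr_union_bound PP (measurable_close_pair hX kn rho) mA.
rewrite big_sumType/= big_const card_unit/= addr0; apply.
move=> t /(close_pair_sub hl hX kn v0 vu r0)[zt|[p _ pt]].
  by exists (inl tt).
by exists (inr p).
Qed.

Hypothesis N0 : (0 < N)%N.

Let nE : n = expR (l%:R * y).
Proof. by rewrite expRM_natl lnK ?posrE ?ltr0n// natrX. Qed.

Let c0 : 0 < c. Proof. exact: (site_cap_gt0 d2 hP). Qed.
Let y0 : 0 <= y. Proof. by rewrite ln_ge0// ler1n. Qed.

(** The bound on the expected number of vacant pairs at distance at most
    N^(c/8), at the level with parameter s, and the logarithm of the factor by
    which the remaining pairs deviate from independence. *)
Definition near_error (c s : R) : R :=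
  3 ^+ l * expR (s * (1 + c / 4)) * expR (- (c / 8 * y)).
Definition far_exponent (c : R) : R := 6 * l%:R / c * (y * expR (- (c / 16 * y))).

Variable s : R.
Hypothesis s0 : 0 <= s.
Hypothesis sy : s <= l%:R * y.

Let u := (l%:R * y - s) / c.
Let u0 : 0 <= u. Proof. by rewrite divr_ge0 ?(ltW c0)// subr_ge0. Qed.

Let mean : n * expR (- (u * c)) = expR s.
Proof. by rewrite /u mulfVK ?gt_eqF// nE -expRD; congr expR; lra. Qed.

Lemma few_vacant_prob : k%:R <= expR s ->
  (expR s - k%:R) ^+ 2 * pr [set t | (vacant_sites l N pts u t < k)%N] <=
  expR s + (near_error c s + expR s ^+ 2 * expR (far_exponent c)) - expR s ^+ 2.
Proof.
move=> ks; have E0 : 0 < expR (c / 8 * y) by exact: expR_gt0.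
have := few_vacant_le d2 hl hP hnu hpts u0 E0 (k := k).
rewrite /= => /(_ N); rewrite mean => /(_ ks)/le_trans; apply.
rewrite lerD2r lerD2l mulrDr lerD//.
  by rewrite nE; apply: near_pair_term => //; case/andP: hl.
rewrite mulrA -expr2 nE; apply: le_trans (far_pair_term l c0 s0 y0) _.
by rewrite -expRM_natl.
Qed.

Lemma close_vacant_prob (delta : R) : 0 < delta -> 3 * delta <= 1 ->
  1 <= delta * N%:R ->
  \sum_p pr (if close_sites d (delta * N%:R) p then
    vacant pts u [set site p.1; site p.2] else set0) <=
  near_error c s + 3 * delta * (expR (2 * s) * expR (far_exponent c)).
Proof.
move=> d0 d1 dN; have E0 : 0 < expR (c / 8 * y) by exact: expR_gt0.
have r0 : 0 <= delta * N%:R by rewrite mulr_ge0// ltW.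
apply: le_trans (close_vacant_le N d2 hl hP hnu hpts u0 E0 r0) _.
rewrite mulrDr lerD//.
  by rewrite nE; apply: near_pair_term => //; case/andP: hl.
have l0 : (0 < l)%N by case/andP: hl.
have h : (2 * (delta * N%:R) + 1) ^+ l <= 3 * delta * n.
  apply: (@le_trans _ _ ((3 * delta * N%:R) ^+ l)).
    by rewrite lerXn2r ?nnegrE//; lra.
  rewrite exprMn natrX ler_wpM2r ?exprn_ge0//.
  by rewrite -(prednK l0) exprS ler_piMr ?exprn_ile1//; lra.
rewrite mulrCA.
apply: (@le_trans _ _ (3 * delta * n * (n * expR (- (u * (2 * c -
   2 * (3 / Num.sqrt (expR (c / 8 * y))))))))).
  by rewrite ler_wpM2r// mulr_ge0 ?expR_ge0.
rewrite -[leLHS]mulrA ler_pM2l; last by lra.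
by rewrite mulrA -expr2 nE; apply: far_pair_term.
Qed.

End assembly.

Theorem proposition2p8 (R : realType) (d l : nat)
    (hd : (3 <= d)%N) (hl : (1 <= l <= d)%N)
    (P : Zd d -> probability (walk d) R)
    (hP : forall x, srw_law x (P x))
    (nu : {sigma_finite_measure set (Wstar d) -> \bar R})
    (hnu : interlacement_intensity P nu)
    (dT : measure_display) (T : measurableType dT) (PP : probability T R)
    (pts : nat -> T -> option (Wstar d * measurableTypeR R))
    (hpts : interlacement_process PP nu pts)
    (X : nat -> nat -> T -> Zd d)
    (hX : forall N, (1 <= N)%N -> cover_ordering pts (box l N) (N ^ l) (X N))
    (k : nat) (hk : (2 <= k)%N) :
  limn_esup (fun N : nat =>
    PP [set t | exists i j, [/\ (1 <= i)%N, (i < j)%N, (j <= k)%N &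
                enorm R (X N i t - X N j t) <= delta * N%:R]])
    @[delta --> 0^'+] --> 0%E.
Proof.
have c0 := site_cap_gt0 hd hP; set c := site_cap P in c0.
have [l0 _] := andP hl.
apply: cvg_ereal_small => [delta|e e0]; first exact: limn_esup_ge0.
(* S is e^s in the notation of the introduction.  The choice of theta and of
   the bounds on delta makes the four error terms add up to at most e. *)
pose S := Num.max (16 / e) (2 * k%:R).
have Se : 16 / e <= S by rewrite le_max lexx.
have Sk : 2 * k%:R <= S by rewrite le_max lexx orbT.
have k2 : 2 <= k%:R :> R by rewrite ler_nat.
have S1 : 1 <= S by lra.
pose s := ln S; have s0 : 0 <= s by rewrite ln_ge0.
have sE : expR s = S by rewrite lnK// posrE; lra.
pose theta := Num.min (e / 16) 1.
have t0 : 0 < theta by rewrite lt_min ltr01 divr_gt0.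
have [te t1] : theta <= e / 16 /\ theta <= 1 by rewrite !ge_min !lexx orbT.
pose Z := expR (2 * (s + 1)); have Z0 : 0 < Z by exact: expR_gt0.
near=> delta.
have d0 : 0 < delta by [].
have d1 : 3 * delta <= 1.
  have : delta <= 3^-1 by near: delta; apply: nbhs_right_le; rewrite invr_gt0.
  lra.
have dZ : 3 * delta * (Z * 2) <= e / 4.
  have : delta <= e / 4 / (3 * (Z * 2)).
    by near: delta; apply: nbhs_right_le; rewrite !divr_gt0 ?mulr_gt0.
  by rewrite ler_pdivlMr ?mulr_gt0//; lra.
apply: limn_esup_le_near.
have c8 : 0 < c / 8 by lra.
have c16 : 0 < c / 16 by lra.
have e20 : 0 < e / 20 by lra.
have ln1 : 0 < ln (1 + theta) by rewrite ln_gt0; lra.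
have kapN : \forall N \near \oo, near_error l N c (s + 1) <= e / 20.
  apply: (near_ln_nat (Q := fun y => 3 ^+ l * expR ((s + 1) * (1 + c / 4)) *
    expR (- (c / 8 * y)) <= e / 20)).
  exact: expRN_eventually.
have tauN : \forall N \near \oo, far_exponent l N c <= ln (1 + theta).
  apply: (near_ln_nat (Q := fun y => 6 * l%:R / c * (y * expR (- (c / 16 * y)))
    <= ln (1 + theta))).
  exact: mulr_expRN_eventually.
have syN : \forall N \near \oo, s + 1 <= l%:R * ln (N%:R : R).
  apply: (near_ln_nat (Q := fun y => s + 1 <= l%:R * y)); exists (s + 1) => y sy.
  have y0 : 0 <= y by lra.
  by apply: le_trans sy _; rewrite ler_peMl ?ler1n.
near=> N.
have N0 : (0 < N)%N by near: N; exact: nbhs_infty_gt.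
have kN : (k <= N ^ l)%N.
  apply: (@leq_trans N); first by near: N; exact: nbhs_infty_ge.
  by rewrite -{1}[N]expn1 leq_pexp2l.
have dN : 1 <= delta * N%:R.
  by rewrite -ler_pdivrMl// mulr1; near: N; exact: nbhs_infty_ger.
have kap : near_error l N c (s + 1) <= e / 20.
  by near: N.
have tau : expR (far_exponent l N c) <= 1 + theta.
  rewrite -[leRHS]lnK ?posrE ?ler_expR; last by lra.
  by near: N.
have sy : s + 1 <= l%:R * ln (N%:R : R) by near: N.
have kap' : near_error l N c s <= e / 20.
  apply: le_trans kap; rewrite /near_error ler_pM2r ?expR_gt0//.
  rewrite ler_pM2l ?exprn_gt0// ler_expR; lra.
have s10 : 0 <= s + 1 by lra.
have sy' : s <= l%:R * ln (N%:R : R) by lra.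
have ks : k%:R <= expR s by rewrite sE; lra.
have few := few_vacant_prob hd hl hP hnu hpts N0 s0 sy' ks.
have close := close_vacant_prob hd hl hP hnu hpts N0 s10 sy d0 d1 dN.
have v0 : 0 <= (l%:R * ln (N%:R : R) - (s + 1)) / c.
  by rewrite divr_ge0 ?subr_ge0// ltW.
have vu : (l%:R * ln (N%:R : R) - (s + 1)) / c < (l%:R * ln (N%:R : R) - s) / c.
  by rewrite ltr_pM2r ?invr_gt0//; lra.
have r0 : 0 <= delta * N%:R by lra.
have := pr_close_pair_le hl hpts (hX N N0) kN v0 vu r0.
rewrite -/(close_pair (X N) k (delta * N%:R)) (@probE _ _ _ PP); last first.
  exact: measurable_close_pair (hX N N0) kN _.
rewrite lee_fin => /le_trans; apply.
have p7 : fine (PP [set t | (vacant_sites l N pts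
    ((l%:R * ln (N%:R : R) - s) / c) t < k)%N]) <= e * (7 / 10).
  apply: (few_vacant_arith e0 S1 Se Sk kap' (ltW t0) te (pr_ge0 PP _)).
  rewrite -sE; apply: le_trans few _.
  by rewrite lerD2r lerD2l lerD2l ler_pM2l ?exprn_gt0 ?expR_gt0.
have far : 3 * delta * (Z * expR (far_exponent l N c)) <= e / 4.
  apply: le_trans dZ; rewrite ler_pM2l ?mulr_gt0// ler_pM2l//.
  by apply: le_trans tau _; rewrite -[leRHS]/(1 + 1) lerD2l.
have -> : e = e * (7 / 10) + (e / 20 + e / 4) by lra.
by apply: lerD p7 _; apply: le_trans close _; exact: lerD kap far.
Unshelve. all: by end_near. Qed.
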